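(* Let $q$ be a complex number with $0<|q|<1$ and let $A,B,a,b,x,y$ be complex numbers with $\max\{|bq/y|,\,|B/b|,\,|bq/A|\}<1$. Put $$\lambda(y)=\frac{y}{q}\cdot\frac{\left(x,\ \frac{xa^2}{B},\ -\frac{aq}{A},\ -\frac{bq}{A},\ -\frac{ya}{q},\ -\frac{Bq}{ya},\ \frac{xabq}{yAB},\ \frac{xya^2}{ABq};q\right)_\infty}{\left(\frac{xq}{y},\ \frac{xya^2}{Bq},\ -\frac{ya}{A},\ -\frac{bq^2}{yA},\ -a,\ -\frac{B}{a},\ \frac{xab}{AB},\ \frac{xa^2}{AB};q\right)_\infty},$$ $$\theta(y)=\frac{-1}{A+b}\cdot\frac{\left(x,\ \frac{xa^2}{A},\ -\frac{aq}{A},\ -\frac{b}{A};q\right)_\infty}{\left(\frac{xq}{y},\ \frac{xa^2q}{yA},\ -\frac{ya}{A},\ -\frac{bq}{yA};q\right)_\infty}.$$ Then $$\frac1a\sum_{k=0}^{\infty}\frac{\left(-\frac qa,\frac{AB}{ab};q\right)_k(-b)^k}{\left(-\frac Aa,-\frac Ba;q\right)_{k+1}}\cdot\frac{\left(x,y,-\frac{xa}{A},-\frac{xa}{B};q\right)_k(1-q^{2k}x)}{\left(q,-xa,\frac{xq}{y};q\right)_k\left(\frac{xab}{AB};q\right)_{k+1}}\left(\frac qy\right)^k$$ $$-\frac{\lambda(y)}{b}\sum_{k=0}^{\infty}\frac{\left(A,-\frac{ya}{B};q\right)_k\left(-\frac Bb\right)^k}{\left(-\frac{ya}{q},-\frac{yA}{bq};q\right)_{k+1}}\cdot\frac{\left(\frac{xya^2}{Bq},y,-\frac{xa^2b}{AB},-\frac{xa}{B};q\right)_k}{\left(q,-xa,\frac{xa^2}{B};q\right)_k}\cdot\frac{1-q^{2k-1}\frac{xya^2}{B}}{\left(\frac{xya^2}{ABq};q\right)_{k+1}}$$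 $$=\frac{\theta(y)\left(y,\frac{ya}{b},\frac{bq}{ya},A,\frac{Bq}{y},\frac{AB}{ab},-\frac{xa}{B},-\frac{xaq}{yA},-\frac{xa^2bq}{yAB};q\right)_\infty}{\left(-a,-\frac{bq}{y},-\frac Aa,-\frac{yA}{b},-\frac Ba,-\frac Bb,-xa,\frac{xab}{AB},\frac{xa^2}{AB};q\right)_\infty}\;{}_8W_7\!\left(\frac{xa^2}{yA};\frac qy,-\frac{xa}{y},\frac{xa^2}{AB},-a,-\frac Bb;q,-\frac{bq}{A}\right).$$
   Context: Notation. $(x;q)_\infty=\prod_{i=0}^\infty(1-xq^i)$; for a nonnegative integer $n$, $(x;q)_n=(x;q)_\infty/(xq^n;q)_\infty=\prod_{i=0}^{n-1}(1-xq^i)$. For several parameters, $(x_1,\dots,x_r;q)_m=(x_1;q)_m\cdots(x_r;q)_m$ ($m$ an integer $\ge 0$ or $\infty$). The very-well-poised series ${}_8W_7(\alpha;\beta_1,\dots,\beta_5;q,z)$ is $$\sum_{k=0}^\infty\frac{(\alpha,q\sqrt\alpha,-q\sqrt\alpha,\beta_1,\dots,\beta_5;q)_k}{(q,\sqrt\alpha,-\sqrt\alpha,\alpha q/\beta_1,\dots,\alpha q/\beta_5;q)_k}z^k,\qquad\text{where }\frac{(q\sqrt\alpha,-q\sqrt\alpha;q)_k}{(\sqrt\alpha,-\sqrt\alpha;q)_k}=\frac{1-\alpha q^{2k}}{1-\alpha}.$$ Standing convention: the parameters are such that every expression occurring is well defined (no denominator vanishes, including the denominator factors of the terms of the series). 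*)

(* Defs.v *)
From Stdlib Require Import Reals List Lia.
From Coquelicot Require Import Coquelicot.
Import ListNotations.
Open Scope R_scope.
Open Scope C_scope.

(* Limits and sums of complex sequences, taken componentwise; as with
   [Lim_seq] and [Series], the values are meaningful only in case of
   convergence. *)
Definition CLim_seq (u : nat -> C) : C :=
  (real (Lim_seq (fun n => Re (u n))), real (Lim_seq (fun n => Im (u n)))).

Definition CSeries (u : nat -> C) : C :=
  (Series (fun n => Re (u n)), Series (fun n => Im (u n))).

Definition ex_Cseries (u : nat -> C) : Prop :=
  @ex_series C_AbsRing C_NormedModule u.

Lemma CLim_seq_unique (u : nat -> C) (l : C) :
  filterlim u eventually (locally l) -> CLim_seq u = l.
Proof.
intros H; unfold CLim_seq; destruct l as [l1 l2]; f_equal.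
- replace l1 with (real (Finite l1)) by reflexivity; f_equal.
  apply is_lim_seq_unique; intros P [e He].
  apply (H (fun y : C => P (Re y))).
  exists e; intros y [Hy _]; exact (He _ Hy).
- replace l2 with (real (Finite l2)) by reflexivity; f_equal.
  apply is_lim_seq_unique; intros P [e He].
  apply (H (fun y : C => P (Im y))).
  exists e; intros y [_ Hy]; exact (He _ Hy).
Qed.

Lemma CSeries_unique (u : nat -> C) (l : C) :
  @is_series C_AbsRing C_NormedModule u l -> CSeries u = l.
Proof.
intros H; rewrite <- (CLim_seq_unique _ _ H); unfold CSeries, CLim_seq, Series.
f_equal; f_equal; apply Lim_seq_ext; intros n.
- induction n as [|n IH]; [now rewrite !sum_O | now rewrite !sum_Sn, IH].
- induction n as [|n IH]; [now rewrite !sum_O | now rewrite !sum_Sn, IH].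
Qed.

Fixpoint qpoch (x q : C) (n : nat) : C :=
  match n with
  | O => 1
  | S m => qpoch x q m * (1 - x * q ^ m)
  end.

Definition qpoch_inf (x q : C) : C := CLim_seq (qpoch x q).

(* Several parameters: (x_1, ..., x_r; q)_n and (x_1, ..., x_r; q)_oo. *)
Definition qpochs (l : list C) (q : C) (n : nat) : C :=
  fold_right (fun x p => qpoch x q n * p) (RtoC 1) l.

Definition qpochs_inf (l : list C) (q : C) : C :=
  fold_right (fun x p => qpoch_inf x q * p) (RtoC 1) l.

(* The factor (q r, -q r; q)_k / (r, -r; q)_k, with r a square root of alpha,
   enters [W87_term] as (1 - alpha q^(2k)) / (1 - alpha). *)
Lemma very_well_poised_factor (alpha r q : C) (k : nat) :
  r * r = alpha -> 1 - alpha <> 0 -> qpochs [r; - r] q k <> 0 ->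
  qpochs [q * r; - (q * r)] q k / qpochs [r; - r] q k
  = (1 - alpha * q ^ (2 * k)) / (1 - alpha).
Proof.
intros Hr Ha Hk.
assert (E : qpochs [q * r; - (q * r)] q k * (1 - alpha)
            = (1 - alpha * q ^ (2 * k)) * qpochs [r; - r] q k).
{ clear Hk; rewrite <- Hr; simpl qpochs; induction k as [|k IH].
  - simpl; ring.
  - replace (2 * S k)%nat with (S (S (2 * k))) in * by lia.
    replace (2 * k)%nat with (k + k)%nat in * by lia.
    rewrite Cpow_add_r in IH; simpl qpoch; rewrite !Cpow_S, Cpow_add_r.
    set (t := q ^ k) in *; set (u := qpoch (q * r) q k) in *.
    set (v := qpoch (- (q * r)) q k) in *.
    transitivity ((u * (v * 1) * (1 - r * r)) * (1 - q * r * t) * (1 + q * r * t));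
      [ring | rewrite IH; ring]. }
apply (f_equal (fun z => z / (1 - alpha) / qpochs [r; - r] q k)) in E.
transitivity (qpochs [q * r; - (q * r)] q k * (1 - alpha)
              / (1 - alpha) / qpochs [r; - r] q k);
  [field | rewrite E; field]; split; assumption.
Qed.

Definition W87_den (alpha b1 b2 b3 b4 b5 q : C) (k : nat) : C :=
  qpochs [q; alpha * q / b1; alpha * q / b2; alpha * q / b3;
          alpha * q / b4; alpha * q / b5] q k * (1 - alpha).

Definition W87_term (alpha b1 b2 b3 b4 b5 q z : C) (k : nat) : C :=
  qpochs [alpha; b1; b2; b3; b4; b5] q k * (1 - alpha * q ^ (2 * k))
  / W87_den alpha b1 b2 b3 b4 b5 q k * z ^ k.

Definition W87 (alpha b1 b2 b3 b4 b5 q z : C) : C :=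
  CSeries (W87_term alpha b1 b2 b3 b4 b5 q z).

Definition lambda_den (q A B a b x y : C) : C :=
  qpochs_inf [x * q / y; x * y * a ^ 2 / (B * q); - (y * a / A);
              - (b * q ^ 2 / (y * A)); - a; - (B / a);
              x * a * b / (A * B); x * a ^ 2 / (A * B)] q.

Definition lambda (q A B a b x y : C) : C :=
  y / q *
  (qpochs_inf [x; x * a ^ 2 / B; - (a * q / A); - (b * q / A);
               - (y * a / q); - (B * q / (y * a));
               x * a * b * q / (y * A * B); x * y * a ^ 2 / (A * B * q)] q
   / lambda_den q A B a b x y).

Definition theta_den (q A B a b x y : C) : C :=
  qpochs_inf [x * q / y; x * a ^ 2 * q / (y * A); - (y * a / A);
              - (b * q / (y * A))] q.

Definition theta (q A B a b x y : C) : C :=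
  - (1) / (A + b) *
  (qpochs_inf [x; x * a ^ 2 / A; - (a * q / A); - (b / A)] q
   / theta_den q A B a b x y).

Definition sum1_den (q A B a b x y : C) (k : nat) : C :=
  qpochs [- (A / a); - (B / a)] q (S k) *
  (qpochs [q; - (x * a); x * q / y] q k *
   qpoch (x * a * b / (A * B)) q (S k)).

Definition sum1_term (q A B a b x y : C) (k : nat) : C :=
  qpochs [- (q / a); A * B / (a * b)] q k * (- b) ^ k *
  (qpochs [x; y; - (x * a / A); - (x * a / B)] q k * (1 - q ^ (2 * k) * x))
  / sum1_den q A B a b x y k * (q / y) ^ k.

Definition sum2_den (q A B a b x y : C) (k : nat) : C :=
  qpochs [- (y * a / q); - (y * A / (b * q))] q (S k) *
  qpochs [q; - (x * a); x * a ^ 2 / B] q k *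
  qpoch (x * y * a ^ 2 / (A * B * q)) q (S k).

(* q^(2k-1) is written q^(2k) / q, the exponent being -1 for k = 0. *)
Definition sum2_term (q A B a b x y : C) (k : nat) : C :=
  qpochs [A; - (y * a / B)] q k * (- (B / b)) ^ k *
  qpochs [x * y * a ^ 2 / (B * q); y; - (x * a ^ 2 * b / (A * B));
          - (x * a / B)] q k *
  (1 - q ^ (2 * k) / q * (x * y * a ^ 2 / B))
  / sum2_den q A B a b x y k.

Definition rhs_den (q A B a b x y : C) : C :=
  qpochs_inf [- a; - (b * q / y); - (A / a); - (y * A / b); - (B / a);
              - (B / b); - (x * a); x * a * b / (A * B);
              x * a ^ 2 / (A * B)] q.

Definition rhs_factor (q A B a b x y : C) : C :=
  theta q A B a b x y *
  qpochs_inf [y; y * a / b; b * q / (y * a); A; B * q / y; A * B / (a * b);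
              - (x * a / B); - (x * a * q / (y * A));
              - (x * a ^ 2 * b * q / (y * A * B))] q
  / rhs_den q A B a b x y.

(* Main.v *)
Require Import Defs.
From Stdlib Require Import Reals List Lra Lia.
From Coquelicot Require Import Coquelicot.
Import ListNotations.
Open Scope R_scope.
Open Scope C_scope.

(* Up to elementary factors, the three series are the very-well-poised 8W7's
   attached to pairs of the three points p1 = -bq/(Ay), p2 = 1, p3 = -a/A.  Put
   p4 = -q/(ax), let r run over y, -ax/B, AB/(ab), A, so that the product of the
   p's and the r's is q^2, and let
     F(t) = prod_l (qt/p_l; q)_oo / prod_r (rt; q)_oo,
     I(p) = sum_m p q^m F(p q^m).
   The nonterminating Watson formula expresses I(p_j) - I(p_i) as a multiple of
   an 8W7, so the theorem is the trivial relation between the differences of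
   I(p1), I(p2), I(p3), once the infinite products are matched.

   Watson's formula is obtained by summing over n the q-Saalschutz evaluations
   of two balanced 3phi2's with parameters shifted by q^n, and exchanging the
   sums: the inner sum over n becomes a 6phi5.  Both evaluations (3phi2 and
   6phi5) come from a first-order recurrence with telescoping partial sums,
   iterated to its limit, and from one case where the series is elementary.
   All identities are multiplied out so that no product such as (rp; q)_oo is
   ever inverted; this covers the parameter values at which they vanish. *)

(** * Convergence of complex sequences and series *)

(** The configuration of points is read off the arguments of the three series: -bq/y = p1 A, -B/b =
    p3 AB/(ab) and -bq/A = p1 y. Each use of Watson's formula thus singles out another r (A, then
    AB/(ab), then y), and the three bounds in the hypothesis are the conditions |z| < 1. The
    obstacle in the exchange of sums is convergence in n. The inner 6phi5 has argument s = b q^m in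
    one half and s = b y q^m in the other. The second is less than 1 in modulus, since z = b y; the
    first need not be, but there the series in n terminates. The estimates therefore treat both
    kinds of s at once, and s^n (b/s; q)_n is kept as a polynomial in s, so that s = 0, the limit of
    the recurrence s -> sq, is an ordinary value. For the 3phi2's, each of the two series alone
    satisfies only an inhomogeneous recurrence in b1 -> b1 q. Its boundary term is symmetric in the
    two ends of the underlying q-integral, so it drops out of the difference; this is why a pair of
    series, not a single one, has a product evaluation. *)

Lemma Cmult_cancel_l (c x y : C) : c <> 0 -> c * x = c * y -> x = y.
Proof.
intros hc H; replace x with (/ c * (c * x)) by (field; exact hc).
rewrite H; field; exact hc.
Qed.

Lemma Cinv_neq_0 (x : C) : x <> 0 -> / x <> 0.
Proof. intros h E; apply C1_nz; rewrite <- (Cinv_r x h), E; ring. Qed.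

(** An explicit epsilon form, convenient for estimates on [Cmod]; [cvg_filterlim] and
    [filterlim_cvg] translate to and from the filters behind [CLim_seq] and [is_series]. *)
Definition cvg (u : nat -> C) (l : C) : Prop :=
  forall eps : R, (0 < eps)%R ->
  exists N, forall n, (N <= n)%nat -> (Cmod (u n - l) < eps)%R.

(** Starts from the empty sum, whereas [sum_n] at n already has n + 1 terms; hence the shifts by 1
    in the conversions to [is_series]. *)
Fixpoint psum (u : nat -> C) (n : nat) : C :=
  match n with
  | O => 0
  | S m => psum u m + u m
  end.

Definition has_sum (u : nat -> C) (l : C) : Prop := cvg (psum u) l.

Lemma Cmod_minus_sym (x y : C) : Cmod (x - y) = Cmod (y - x).
Proof. rewrite <- Cmod_opp; f_equal; ring. Qed.

Lemma Cmod_triangle_minus (x y : C) : (Cmod (x - y) <= Cmod x + Cmod y)%R.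
Proof. rewrite <- (Cmod_opp y); apply Cmod_triangle. Qed.

Lemma Cmod_dist (x y z : C) : (Cmod (x - z) <= Cmod (x - y) + Cmod (y - z))%R.
Proof. replace (x - z) with ((x - y) + (y - z)) by ring; apply Cmod_triangle. Qed.

Lemma Cmod_eq_0_of_small (x : C) :
  (forall eps, (0 < eps)%R -> (Cmod x < eps)%R) -> x = 0.
Proof.
intros H; apply Cmod_eq_0.
destruct (Rle_lt_or_eq_dec 0 (Cmod x) (Cmod_ge_0 x)) as [h|h]; [|now symmetry].
specialize (H _ h); lra.
Qed.

Lemma cvg_unique (u : nat -> C) (l l' : C) : cvg u l -> cvg u l' -> l = l'.
Proof.
intros H H'; replace l with ((l - l') + l') by ring.
replace (l - l') with (RtoC 0); [ring | symmetry].
apply Cmod_eq_0_of_small; intros e he.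
destruct (H (e / 2)%R) as [N HN]; [lra|]; destruct (H' (e / 2)%R) as [N' HN']; [lra|].
pose proof (HN (N + N')%nat ltac:(lia)); pose proof (HN' (N + N')%nat ltac:(lia)).
pose proof (Cmod_dist l (u (N + N')%nat) l') as T.
rewrite (Cmod_minus_sym l (u _)) in T; lra.
Qed.

Lemma cvg_ext (u v : nat -> C) (l : C) : (forall n, u n = v n) -> cvg u l -> cvg v l.
Proof. intros E H e he; destruct (H e he) as [N HN]; exists N; intros; rewrite <- E; auto. Qed.

Lemma cvg_const (c : C) : cvg (fun _ => c) c.
Proof.
intros e he; exists O; intros; replace (c - c) with (RtoC 0) by ring; now rewrite Cmod_0.
Qed.

Lemma cvg_plus (u v : nat -> C) (l m : C) :
  cvg u l -> cvg v m -> cvg (fun n => u n + v n) (l + m).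
Proof.
intros H H' e he.
destruct (H (e / 2)%R) as [N HN]; [lra|]; destruct (H' (e / 2)%R) as [N' HN']; [lra|].
exists (N + N')%nat; intros n hn.
pose proof (HN n ltac:(lia)); pose proof (HN' n ltac:(lia)).
replace (u n + v n - (l + m)) with ((u n - l) + (v n - m)) by ring.
pose proof (Cmod_triangle (u n - l) (v n - m)); lra.
Qed.

Lemma cvg_bounded (u : nat -> C) (l : C) :
  cvg u l -> exists N, forall n, (N <= n)%nat -> (Cmod (u n) <= Cmod l + 1)%R.
Proof.
intros H; destruct (H 1%R) as [N HN]; [lra|]; exists N; intros n hn.
pose proof (HN n hn); replace (u n) with ((u n - l) + l) by ring.
pose proof (Cmod_triangle (u n - l) l); lra.
Qed.

Lemma cvg_mult (u v : nat -> C) (l m : C) :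
  cvg u l -> cvg v m -> cvg (fun n => u n * v n) (l * m).
Proof.
intros H H' e he.
destruct (cvg_bounded u l H) as [N0 H0].
pose proof (Cmod_ge_0 l); pose proof (Cmod_ge_0 m).
set (K := (Cmod l + Cmod m + 1)%R) in *.
assert (hK : (0 < K)%R) by (unfold K; lra).
assert (he' : (0 < e / 2 / K)%R) by (apply Rdiv_lt_0_compat; lra).
destruct (H _ he') as [N HN]; destruct (H' _ he') as [N' HN'].
exists (N0 + N + N')%nat; intros n hn.
pose proof (HN n ltac:(lia)) as A; pose proof (HN' n ltac:(lia)) as A'.
pose proof (H0 n ltac:(lia)) as A0.
replace (u n * v n - l * m) with (u n * (v n - m) + m * (u n - l)) by ring.
eapply Rle_lt_trans; [apply Cmod_triangle|]; rewrite !Cmod_mult.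
assert (B : (K * (e / 2 / K) = e / 2)%R) by (field; lra).
assert ((Cmod (u n) * Cmod (v n - m) <= K * Cmod (v n - m))%R)
  by (apply Rmult_le_compat_r; [apply Cmod_ge_0 | unfold K; lra]).
assert ((Cmod m * Cmod (u n - l) <= K * Cmod (u n - l))%R)
  by (apply Rmult_le_compat_r; [apply Cmod_ge_0 | unfold K; lra]).
apply (Rmult_lt_compat_l K) in A; [|exact hK].
apply (Rmult_lt_compat_l K) in A'; [|exact hK]; lra.
Qed.

Lemma cvg_scal (c : C) (u : nat -> C) (l : C) : cvg u l -> cvg (fun n => c * u n) (c * l).
Proof. intros H; apply cvg_mult; [apply cvg_const | exact H]. Qed.

Lemma cvg_shift (k : nat) (u : nat -> C) (l : C) : cvg u l -> cvg (fun n => u (k + n)%nat) l.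
Proof. intros H e he; destruct (H e he) as [N HN]; exists N; intros; apply HN; lia. Qed.

Lemma cvg_unshift (k : nat) (u : nat -> C) (l : C) : cvg (fun n => u (k + n)%nat) l -> cvg u l.
Proof.
intros H e he; destruct (H e he) as [N HN]; exists (k + N)%nat; intros n hn.
replace n with (k + (n - k))%nat by lia; apply HN; lia.
Qed.

Lemma cvg_Cmod_le (u : nat -> C) (l : C) (K : R) :
  cvg u l -> (forall n, (Cmod (u n) <= K)%R) -> (Cmod l <= K)%R.
Proof.
intros H HK; apply Rnot_lt_le; intros h.
destruct (H (Cmod l - K)%R) as [N HN]; [lra|].
pose proof (HN N (le_n _)); pose proof (HK N).
pose proof (Cmod_triangle_minus (u N) (u N - l)) as T.
replace (u N - (u N - l)) with l in T by ring; lra.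
Qed.

Lemma cvg_squeeze (u : nat -> C) (l : C) (v : nat -> R) :
  (forall n, (Cmod (u n - l) <= v n)%R) -> is_lim_seq v 0%R -> cvg u l.
Proof.
intros H Hv e he.
apply is_lim_seq_spec in Hv; destruct (Hv (mkposreal e he)) as [N HN]; simpl in HN.
exists N; intros n hn; specialize (HN n hn); rewrite Rminus_0_r in HN.
pose proof (Rle_abs (v n)); specialize (H n); lra.
Qed.

Lemma cvg_geom (x : C) : (Cmod x < 1)%R -> cvg (fun n => x ^ n) 0.
Proof.
intros h; apply (cvg_squeeze _ _ (fun n => (Cmod x ^ n)%R)).
- intros n; right; rewrite <- Cmod_pow; f_equal; ring.
- apply is_lim_seq_geom; rewrite Rabs_pos_eq; [exact h | apply Cmod_ge_0].
Qed.

Lemma cvg_filterlim (u : nat -> C) (l : C) :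
  cvg u l -> filterlim u eventually (@locally (NormedModule.UniformSpace C_AbsRing C_NormedModule) l).
Proof.
intros H; apply (filterlim_locally_ball_norm (U := C_NormedModule)).
intros e; destruct (H e (cond_pos e)) as [N HN]; exists N; intros n hn; exact (HN n hn).
Qed.

Lemma filterlim_cvg (u : nat -> C) (l : C) :
  filterlim u eventually (@locally (NormedModule.UniformSpace C_AbsRing C_NormedModule) l) -> cvg u l.
Proof.
intros H e he.
destruct (proj1 (filterlim_locally_ball_norm (U := C_NormedModule) _ _) H (mkposreal e he)) as [N HN].
exists N; intros n hn; exact (HN n hn).
Qed.

Lemma CLim_seq_cvg (u : nat -> C) (l : C) : cvg u l -> CLim_seq u = l.
Proof. intros H; apply CLim_seq_unique, cvg_filterlim, H. Qed.

Lemma psum_sum_n (u : nat -> C) (n : nat) :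
  psum u (S n) = @sum_n (NormedModule.AbelianMonoid C_AbsRing C_NormedModule) u n.
Proof.
induction n as [|n IH]; [rewrite sum_O; simpl; ring|].
rewrite sum_Sn, <- IH; reflexivity.
Qed.

Lemma has_sum_is_series (u : nat -> C) (l : C) :
  has_sum u l -> @is_series C_AbsRing C_NormedModule u l.
Proof.
intros H; apply cvg_filterlim.
apply (cvg_ext (fun n => psum u (1 + n)%nat)); [exact (psum_sum_n u) | now apply (cvg_shift 1)].
Qed.

Lemma is_series_has_sum (u : nat -> C) (l : C) :
  @is_series C_AbsRing C_NormedModule u l -> has_sum u l.
Proof.
intros H; apply filterlim_cvg in H; apply (cvg_unshift 1).
apply (cvg_ext (@sum_n (NormedModule.AbelianMonoid C_AbsRing C_NormedModule) u));
  [intros n; symmetry; apply psum_sum_n | exact H].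
Qed.

Lemma psum_ext (u v : nat -> C) (n : nat) : (forall k, u k = v k) -> psum u n = psum v n.
Proof. intros E; induction n as [|n IH]; [reflexivity | simpl; now rewrite IH, E]. Qed.

Lemma psum_plus (u v : nat -> C) (n : nat) :
  psum (fun k => u k + v k) n = psum u n + psum v n.
Proof. induction n as [|n IH]; simpl; [ring | rewrite IH; ring]. Qed.

Lemma psum_scal (c : C) (u : nat -> C) (n : nat) :
  psum (fun k => c * u k) n = c * psum u n.
Proof. induction n as [|n IH]; simpl; [ring | rewrite IH; ring]. Qed.

Lemma psum_add (u : nat -> C) (m n : nat) :
  psum u (m + n) = psum u m + psum (fun k => u (m + k)%nat) n.
Proof.
induction n as [|n IH]; simpl; [rewrite Nat.add_0_r; ring|].
rewrite Nat.add_succ_r; simpl; rewrite IH; ring.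
Qed.

Lemma psum_zero (u : nat -> C) (n : nat) :
  (forall k, (k < n)%nat -> u k = 0) -> psum u n = 0.
Proof.
intros H; induction n as [|n IH]; simpl; [reflexivity|].
rewrite IH, H by (intros; try apply H; lia); ring.
Qed.

Lemma has_sum_ext (u v : nat -> C) (l : C) :
  (forall n, u n = v n) -> has_sum u l -> has_sum v l.
Proof. intros E; apply cvg_ext; intros n; now apply psum_ext. Qed.

Lemma has_sum_unique (u : nat -> C) (l l' : C) : has_sum u l -> has_sum u l' -> l = l'.
Proof. apply cvg_unique. Qed.

Lemma has_sum_plus (u v : nat -> C) (l m : C) :
  has_sum u l -> has_sum v m -> has_sum (fun n => u n + v n) (l + m).
Proof.
intros H H'; eapply cvg_ext; [|apply (cvg_plus _ _ _ _ H H')].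
intros n; symmetry; apply psum_plus.
Qed.

Lemma has_sum_scal (c : C) (u : nat -> C) (l : C) :
  has_sum u l -> has_sum (fun n => c * u n) (c * l).
Proof.
intros H; eapply cvg_ext; [|apply (cvg_scal c _ _ H)].
intros n; symmetry; apply psum_scal.
Qed.

Lemma has_sum_finite (u : nat -> C) (n : nat) :
  (forall k, (n <= k)%nat -> u k = 0) -> has_sum u (psum u n).
Proof.
intros H; apply (cvg_unshift n).
apply (cvg_ext (fun _ => psum u n)); [|apply cvg_const].
intros k; rewrite psum_add, (psum_zero (fun j => u (n + j)%nat)); [ring|].
intros; apply H; lia.
Qed.

Lemma has_sum_shift (u : nat -> C) (n : nat) (l : C) :
  (forall k, (k < n)%nat -> u k = 0) ->
  has_sum (fun k => u (n + k)%nat) l -> has_sum u l.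
Proof.
intros H0 H; apply (cvg_unshift n).
eapply cvg_ext; [|exact H]; intros k; simpl.
rewrite psum_add, (psum_zero u n H0); ring.
Qed.

Lemma has_sum_psum (f : nat -> nat -> C) (s : nat -> C) (n : nat) :
  (forall i, has_sum (f i) (s i)) ->
  has_sum (fun k => psum (fun i => f i k) n) (psum s n).
Proof.
intros H; induction n as [|n IH]; simpl.
- apply (has_sum_finite (fun _ => RtoC 0) 0); reflexivity.
- now apply has_sum_plus.
Qed.

(** * Geometric majorants, Tannery's theorem and exchange of sums *)

Definition geom_dominated (K r : R) (u : nat -> C) : Prop :=
  (0 <= r < 1)%R /\ forall n, (Cmod (u n) <= K * r ^ n)%R.

Lemma geom_dominated_K (K r : R) (u : nat -> C) : geom_dominated K r u -> (0 <= K)%R.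
Proof.
intros [_ H]; specialize (H O); pose proof (Cmod_ge_0 (u O)); simpl in H; lra.
Qed.

Lemma Cmod_psum_geom (K r : R) (u : nat -> C) (m : nat) :
  geom_dominated K r u -> (Cmod (psum u m) <= K / (1 - r))%R.
Proof.
intros H; pose proof (geom_dominated_K _ _ _ H) as hK; destruct H as [hr H].
assert (A : (Cmod (psum u m) <= K * (1 - r ^ m) / (1 - r))%R).
{ induction m as [|m IH]; simpl.
  - rewrite Cmod_0; right; field; lra.
  - eapply Rle_trans; [apply Cmod_triangle|].
    replace (K * (1 - r * r ^ m) / (1 - r))%R
      with (K * (1 - r ^ m) / (1 - r) + K * r ^ m)%R by (field; lra).
    specialize (H m); lra. }
eapply Rle_trans; [exact A|].
apply Rmult_le_compat_r; [apply Rlt_le, Rinv_0_lt_compat; lra|].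
pose proof (pow_le r m (proj1 hr)); nra.
Qed.

Lemma geom_dominated_shift (K r : R) (u : nat -> C) (n : nat) :
  geom_dominated K r u -> geom_dominated (K * r ^ n) r (fun k => u (n + k)%nat).
Proof.
intros [hr H]; split; [exact hr|]; intros k.
eapply Rle_trans; [apply H|]; rewrite pow_add; right; ring.
Qed.

Lemma has_sum_tail (K r : R) (u : nat -> C) (l : C) (n : nat) :
  geom_dominated K r u -> has_sum u l ->
  (Cmod (l - psum u n) <= K * r ^ n / (1 - r))%R.
Proof.
intros H Hl.
apply (cvg_Cmod_le (psum (fun k => u (n + k)%nat))).
- apply (cvg_ext (fun k => psum u (n + k) + - psum u n)).
  + intros k; rewrite psum_add; ring.
  + apply cvg_plus; [now apply cvg_shift | apply cvg_const].
- intros k; now apply Cmod_psum_geom, geom_dominated_shift.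
Qed.

Lemma geom_dominated_summable (K r : R) (u : nat -> C) :
  geom_dominated K r u -> exists l, has_sum u l.
Proof.
intros [hr H].
destruct (@ex_series_le C_AbsRing C_CompleteNormedModule u (fun n => K * r ^ n)%R H) as [l Hl].
- apply (ex_series_scal (K := R_AbsRing) (V := R_NormedModule)), ex_series_geom.
  rewrite Rabs_pos_eq; lra.
- exists l; now apply is_series_has_sum.
Qed.

Lemma is_lim_geom_scal (K r : R) : (0 <= r < 1)%R -> is_lim_seq (fun n => K * r ^ n)%R 0%R.
Proof.
intros hr; replace (Finite 0) with (Rbar_mult K 0%R) by (simpl; f_equal; ring).
apply is_lim_seq_scal_l, is_lim_seq_geom; rewrite Rabs_pos_eq; lra.
Qed.

Lemma cvg_psum (u : nat -> nat -> C) (v : nat -> C) (n : nat) :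
  (forall k, cvg (fun i => u i k) (v k)) -> cvg (fun i => psum (u i) n) (psum v n).
Proof.
intros H; induction n as [|n IH]; simpl; [apply cvg_const | now apply cvg_plus].
Qed.

(** Tannery's theorem. The majorant does not depend on [i], so one cut makes the tails of all [u i]
    and of [v] smaller than e/3, and the finitely many terms before the cut converge. *)
Lemma has_sum_tannery (K r : R) (u : nat -> nat -> C) (v s : nat -> C) :
  (forall i, geom_dominated K r (u i)) ->
  (forall k, cvg (fun i => u i k) (v k)) ->
  (forall i, has_sum (u i) (s i)) ->
  exists l, has_sum v l /\ cvg s l.
Proof.
intros HK Hv Hs.
assert (Hr := proj1 (HK O)).
assert (Hd : geom_dominated K r v).
{ split; [exact Hr|]; intros k; apply (cvg_Cmod_le _ _ _ (Hv k)).
  intros i; apply (proj2 (HK i)). }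
destruct (geom_dominated_summable _ _ _ Hd) as [l Hl]; exists l; split; [exact Hl|].
intros e he.
pose proof (is_lim_geom_scal (K / (1 - r)) r Hr) as G.
apply is_lim_seq_spec in G.
assert (he3 : (0 < e / 3)%R) by lra.
destruct (G (mkposreal _ he3)) as [n Hn]; specialize (Hn n (le_n _)); simpl in Hn.
rewrite Rminus_0_r in Hn; pose proof (Rle_abs (K / (1 - r) * r ^ n)) as Hn'.
destruct (cvg_psum u v n Hv _ he3) as [N HN]; exists N; intros i hi.
specialize (HN i hi).
pose proof (has_sum_tail _ _ _ _ n (HK i) (Hs i)) as T1.
pose proof (has_sum_tail _ _ _ _ n Hd Hl) as T2.
replace (K * r ^ n / (1 - r))%R with (K / (1 - r) * r ^ n)%R in T1, T2 by (field; lra).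
pose proof (Cmod_dist (s i) (psum (u i) n) l).
pose proof (Cmod_dist (psum (u i) n) (psum v n) l) as T3.
rewrite (Cmod_minus_sym l) in T2; lra.
Qed.

(** Tannery's theorem for the sums of the first i rows: in column m they tend to [t m], they are
    bounded by K/(1-r) r'^m, and their sum over m is [psum s i]. *)
Lemma has_sum_exchange (K r r' : R) (u : nat -> nat -> C) (s t : nat -> C) (l : C) :
  (0 <= r < 1)%R -> (0 <= r' < 1)%R ->
  (forall n m, (Cmod (u n m) <= K * r ^ n * r' ^ m)%R) ->
  (forall n, has_sum (u n) (s n)) ->
  (forall m, has_sum (fun n => u n m) (t m)) ->
  has_sum t l -> has_sum s l.
Proof.
intros hr hr' Hu Hs Ht Hl.
destruct (has_sum_tannery (K / (1 - r)) r'
  (fun i m => psum (fun n => u n m) i) t (psum s)) as [l' [H1 H2]].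
- intros i; split; [exact hr'|]; intros m.
  replace (K / (1 - r) * r' ^ m)%R with (K * r' ^ m / (1 - r))%R by (field; lra).
  apply Cmod_psum_geom; split; [exact hr|]; intros n.
  eapply Rle_trans; [apply Hu|]; right; ring.
- exact Ht.
- intros i; now apply has_sum_psum.
- now rewrite (has_sum_unique _ _ _ Hl H1).
Qed.

(** * q-shifted factorials *)

Section QPochhammer.

Variable q : C.
Hypothesis hq : (Cmod q < 1)%R.

(** A majorant of prod (1 + |x| |q|^i), by 1 + t <= exp t and the geometric series. It depends on
    |x| only and increases with it, so it also serves for every x q^n. *)
Definition qbound (x : C) : R := exp (Cmod x / (1 - Cmod q)).

Lemma Cmod_q_range : (0 <= Cmod q < 1)%R.
Proof. split; [apply Cmod_ge_0 | exact hq]. Qed.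

Lemma Cmod_q_pow_le (n : nat) : (Cmod (q ^ n) <= 1)%R.
Proof.
rewrite Cmod_pow, <- (pow1 n); apply pow_incr.
pose proof Cmod_q_range; lra.
Qed.

Lemma qbound_ge_1 (x : C) : (1 <= qbound x)%R.
Proof.
unfold qbound; rewrite <- exp_0 at 1.
assert (0 <= Cmod x / (1 - Cmod q))%R
  by (apply Rdiv_le_0_compat; [apply Cmod_ge_0 | lra]).
destruct H as [H|H]; [left; now apply exp_increasing | rewrite H; lra].
Qed.

Lemma qbound_incr (x y : C) : (Cmod x <= Cmod y)%R -> (qbound x <= qbound y)%R.
Proof.
intros H; unfold qbound.
assert (Cmod x / (1 - Cmod q) <= Cmod y / (1 - Cmod q))%R
  by (apply Rmult_le_compat_r; [apply Rlt_le, Rinv_0_lt_compat; lra | exact H]).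
destruct H0 as [H0|H0]; [left; now apply exp_increasing | rewrite H0; lra].
Qed.

Lemma qbound_mult_pow (x : C) (n : nat) : (qbound (x * q ^ n) <= qbound x)%R.
Proof.
apply qbound_incr; rewrite Cmod_mult.
pose proof (Cmod_q_pow_le n); pose proof (Cmod_ge_0 x); nra.
Qed.

Fixpoint rprod (s r : R) (n : nat) : R :=
  match n with
  | O => 1
  | S m => rprod s r m * (1 + s * r ^ m)
  end.

Lemma rprod_ge_1 (s r : R) (n : nat) : (0 <= s)%R -> (0 <= r)%R -> (1 <= rprod s r n)%R.
Proof.
intros hs hr; induction n as [|n IH]; simpl; [lra|].
pose proof (Rmult_le_pos _ _ hs (pow_le r n hr)); nra.
Qed.

Lemma rprod_le (s r : R) (n : nat) :
  (0 <= s)%R -> (0 <= r < 1)%R -> (rprod s r n <= exp (s / (1 - r)))%R.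
Proof.
intros hs hr.
(* The induction goes through with the exact finite geometric sum in the exponent; it is enlarged to
   the infinite one only afterwards. *)
assert (A : (rprod s r n <= exp (s * (1 - r ^ n) / (1 - r)))%R).
{ induction n as [|n IH]; simpl.
  - replace (s * (1 - 1) / (1 - r))%R with 0%R by (field; lra).
    rewrite exp_0; lra.
  - replace (s * (1 - r * r ^ n) / (1 - r))%R
      with (s * (1 - r ^ n) / (1 - r) + s * r ^ n)%R by (field; lra).
    pose proof (pow_le r n (proj1 hr)).
    pose proof (rprod_ge_1 s r n hs (proj1 hr)).
    rewrite exp_plus; apply Rmult_le_compat; [lra | nra | exact IH | apply exp_ineq1_le]. }
eapply Rle_trans; [exact A|].
assert (B : (s * (1 - r ^ n) / (1 - r) <= s / (1 - r))%R).
{ apply Rmult_le_compat_r; [apply Rlt_le, Rinv_0_lt_compat; lra|].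
  pose proof (pow_le r n (proj1 hr)); nra. }
destruct B as [B|B]; [left; now apply exp_increasing | rewrite B; lra].
Qed.

(** Keeping the -1 on both sides gives more than boundedness: it yields (x; q)_n -> 1 as x -> 0,
    uniformly in n. *)
Lemma Cmod_qpoch_minus_1_rprod (x : C) (n : nat) :
  (Cmod (qpoch x q n - 1) <= rprod (Cmod x) (Cmod q) n - 1)%R.
Proof.
induction n as [|n IH].
- simpl; replace (1 - 1) with (RtoC 0) by ring; rewrite Cmod_0; lra.
- simpl.
  replace (qpoch x q n * (1 - x * q ^ n) - 1)
    with ((qpoch x q n - 1) * (1 - x * q ^ n) - x * q ^ n) by ring.
  eapply Rle_trans; [apply Cmod_triangle_minus|].
  rewrite Cmod_mult.
  assert (T : (Cmod (1 - x * q ^ n) <= 1 + Cmod x * Cmod q ^ n)%R).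
  { eapply Rle_trans; [apply Cmod_triangle_minus|].
    rewrite Cmod_1, Cmod_mult, Cmod_pow; lra. }
  rewrite Cmod_mult, Cmod_pow.
  assert (0 <= Cmod x * Cmod q ^ n)%R
    by (apply Rmult_le_pos; [apply Cmod_ge_0 | apply pow_le, Cmod_ge_0]).
  pose proof (Cmod_ge_0 (qpoch x q n - 1)); pose proof (Cmod_ge_0 (1 - x * q ^ n)).
  assert (Cmod (qpoch x q n - 1) * Cmod (1 - x * q ^ n)
          <= (rprod (Cmod x) (Cmod q) n - 1) * (1 + Cmod x * Cmod q ^ n))%R
    by (apply Rmult_le_compat; assumption).
  lra.
Qed.

Lemma Cmod_qpoch_minus_1 (x : C) (n : nat) :
  (Cmod (qpoch x q n - 1) <= qbound x - 1)%R.
Proof.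
eapply Rle_trans; [apply Cmod_qpoch_minus_1_rprod|].
pose proof (rprod_le (Cmod x) (Cmod q) n (Cmod_ge_0 x) Cmod_q_range).
unfold qbound; lra.
Qed.

Lemma Cmod_qpoch_le (x : C) (n : nat) : (Cmod (qpoch x q n) <= qbound x)%R.
Proof.
pose proof (Cmod_qpoch_minus_1 x n); pose proof (Cmod_triangle (qpoch x q n - 1) 1).
replace (qpoch x q n - 1 + 1) with (qpoch x q n) in * by ring.
rewrite Cmod_1 in *; lra.
Qed.

Lemma qpoch_add (x : C) (m n : nat) :
  qpoch x q (m + n) = qpoch x q m * qpoch (x * q ^ m) q n.
Proof.
induction n as [|n IH]; simpl; [rewrite Nat.add_0_r; ring|].
rewrite Nat.add_succ_r; simpl; rewrite IH, Cpow_add_r; ring.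
Qed.

Lemma qpoch_S_l (x : C) (n : nat) : qpoch x q (S n) = (1 - x) * qpoch (x * q) q n.
Proof.
change (S n) with (1 + n)%nat; rewrite qpoch_add; simpl.
f_equal; [ring | f_equal; ring].
Qed.

Lemma qpoch_0_l (n : nat) : qpoch 0 q n = 1.
Proof. induction n as [|n IH]; simpl; [reflexivity | rewrite IH; ring]. Qed.

(** The increments -x q^k (x; q)_k are geometrically dominated, because (x; q)_k is bounded; so the
    product converges as a series. *)
Lemma qpoch_cvg (x : C) : cvg (qpoch x q) (qpoch_inf x q).
Proof.
assert (E : forall n, psum (fun k => - (x * q ^ k) * qpoch x q k) n + 1 = qpoch x q n).
{ induction n as [|n IH]; simpl; [ring | rewrite <- IH; ring]. }
destruct (geom_dominated_summable (Cmod x * qbound x) (Cmod q)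
  (fun k => - (x * q ^ k) * qpoch x q k)) as [l Hl].
- split; [exact Cmod_q_range|]; intros n.
  rewrite Cmod_mult, Cmod_opp, Cmod_mult, Cmod_pow.
  pose proof (Cmod_qpoch_le x n); pose proof (Cmod_ge_0 x).
  pose proof (pow_le (Cmod q) n (Cmod_ge_0 q)).
  replace (Cmod x * qbound x * Cmod q ^ n)%R with (Cmod x * Cmod q ^ n * qbound x)%R by ring.
  apply Rmult_le_compat_l; [now apply Rmult_le_pos | assumption].
- assert (H : cvg (qpoch x q) (l + 1)).
  { eapply cvg_ext; [exact E|]; apply cvg_plus; [exact Hl | apply cvg_const]. }
  unfold qpoch_inf; now rewrite (CLim_seq_cvg _ _ H).
Qed.

Lemma qpoch_inf_split (x : C) (m : nat) :
  qpoch_inf x q = qpoch x q m * qpoch_inf (x * q ^ m) q.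
Proof.
apply (cvg_unique (fun n => qpoch x q (m + n))); [apply cvg_shift, qpoch_cvg|].
eapply cvg_ext; [intros n; symmetry; apply qpoch_add|].
apply cvg_scal, qpoch_cvg.
Qed.

Lemma qpoch_inf_step (x : C) : qpoch_inf x q = (1 - x) * qpoch_inf (x * q) q.
Proof. rewrite (qpoch_inf_split x 1); simpl; f_equal; [ring | f_equal; ring]. Qed.

Lemma qpoch_inf_0_l : qpoch_inf 0 q = 1.
Proof.
apply (cvg_unique (qpoch 0 q)); [apply qpoch_cvg|].
apply (cvg_ext (fun _ => RtoC 1)); [intros n; now rewrite qpoch_0_l | apply cvg_const].
Qed.

Lemma Cmod_qpoch_inf_le (x : C) : (Cmod (qpoch_inf x q) <= qbound x)%R.
Proof. apply (cvg_Cmod_le _ _ _ (qpoch_cvg x)), Cmod_qpoch_le. Qed.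

Lemma Cmod_qpoch_inf_pow_le (x : C) (n : nat) :
  (Cmod (qpoch_inf (x * q ^ n) q) <= qbound x)%R.
Proof. eapply Rle_trans; [apply Cmod_qpoch_inf_le | apply qbound_mult_pow]. Qed.

Lemma Cmod_qpoch_inf_minus_1 (x : C) : (Cmod (qpoch_inf x q - 1) <= qbound x - 1)%R.
Proof.
apply (cvg_Cmod_le (fun n => qpoch x q n + - (1))).
- apply cvg_plus; [apply qpoch_cvg | apply cvg_const].
- apply Cmod_qpoch_minus_1.
Qed.

Lemma qbound_small (e : R) :
  (0 < e)%R -> exists d, (0 < d)%R /\ forall x, (Cmod x < d)%R -> (qbound x - 1 < e)%R.
Proof.
intros he; exists (ln (1 + e) * (1 - Cmod q))%R.
assert (hl : (0 < ln (1 + e))%R) by (rewrite <- ln_1; apply ln_increasing; lra).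
pose proof Cmod_q_range; split; [apply Rmult_lt_0_compat; lra|].
intros x hx; unfold qbound.
assert (A : (exp (Cmod x / (1 - Cmod q)) < exp (ln (1 + e)))%R).
{ apply exp_increasing; apply (Rmult_lt_reg_r (1 - Cmod q)); [lra|].
  unfold Rdiv; rewrite Rmult_assoc, Rinv_l; lra. }
rewrite exp_ln in A; lra.
Qed.

Lemma qpoch_cvg_1 (u : nat -> C) (n : nat) : cvg u 0 -> cvg (fun k => qpoch (u k) q n) 1.
Proof.
intros H e he; destruct (qbound_small e he) as [d [hd Hd]].
destruct (H d hd) as [N HN]; exists N; intros k hk; specialize (HN k hk).
replace (u k - 0) with (u k) in HN by ring.
pose proof (Cmod_qpoch_minus_1 (u k) n); specialize (Hd _ HN); lra.
Qed.

Lemma qpoch_inf_cvg_1 (u : nat -> C) : cvg u 0 -> cvg (fun k => qpoch_inf (u k) q) 1.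
Proof.
intros H e he; destruct (qbound_small e he) as [d [hd Hd]].
destruct (H d hd) as [N HN]; exists N; intros k hk; specialize (HN k hk).
replace (u k - 0) with (u k) in HN by ring.
pose proof (Cmod_qpoch_inf_minus_1 (u k)); specialize (Hd _ HN); lra.
Qed.

Lemma cvg_mult_pow (x : C) : cvg (fun n => x * q ^ n) 0.
Proof.
replace (RtoC 0) with (x * 0) by ring; apply cvg_scal, cvg_geom, hq.
Qed.

Lemma qpoch_neq_0_of_inf (x : C) (n : nat) : qpoch_inf x q <> 0 -> qpoch x q n <> 0.
Proof. intros H E; apply H; rewrite (qpoch_inf_split x n), E; ring. Qed.

(** Some tail (x q^N; q)_oo lies within distance 1 of 1, hence is nonzero; the remaining N factors
    are nonzero by hypothesis. *)
Lemma qpoch_inf_neq_0 (x : C) : (forall n, qpoch x q n <> 0) -> qpoch_inf x q <> 0.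
Proof.
intros H; destruct (qpoch_inf_cvg_1 _ (cvg_mult_pow x) 1%R) as [N HN]; [lra|].
specialize (HN N (le_n _)); rewrite (qpoch_inf_split x N).
apply Cmult_neq_0; [apply H|]; intros E; rewrite E in HN.
replace (0 - 1) with (- (1)) in HN by ring; rewrite Cmod_opp, Cmod_1 in HN; lra.
Qed.

Lemma qpoch_neq_0_of_lt_1 (x : C) (n : nat) : (Cmod x < 1)%R -> qpoch x q n <> 0.
Proof.
intros hx; induction n as [|n IH]; simpl; [exact C1_nz|].
apply Cmult_neq_0; [exact IH|]; intros E.
assert (A : Cmod (x * q ^ n) = 1%R).
{ replace (x * q ^ n) with (RtoC 1 - (1 - x * q ^ n)) by ring; rewrite E.
  replace (1 - 0) with (RtoC 1) by ring; apply Cmod_1. }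
rewrite Cmod_mult in A; pose proof (Cmod_q_pow_le n).
pose proof (Cmod_ge_0 x); pose proof (Cmod_ge_0 (q ^ n)); nra.
Qed.

Lemma qpoch_inf_neq_0_of_lt_1 (x : C) : (Cmod x < 1)%R -> qpoch_inf x q <> 0.
Proof. intros; apply qpoch_inf_neq_0; intros; now apply qpoch_neq_0_of_lt_1. Qed.

(** 1/(x; q)_n = (x q^n; q)_oo / (x; q)_oo, and the numerator is at most [qbound q x]. *)
Lemma qpoch_inv_bounded (x : C) :
  (forall n, qpoch x q n <> 0) -> exists K, forall n, (Cmod (/ qpoch x q n) <= K)%R.
Proof.
intros H; pose proof (qpoch_inf_neq_0 x H) as Hi.
exists (qbound x / Cmod (qpoch_inf x q))%R; intros n.
assert (hi := proj1 (Cmod_gt_0 _) Hi).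
rewrite (qpoch_inf_split x n) in Hi |- *.
assert (Hn : qpoch_inf (x * q ^ n) q <> 0) by (intros E; apply Hi; rewrite E; ring).
assert (hn := proj1 (Cmod_gt_0 _) Hn); assert (hp := proj1 (Cmod_gt_0 _) (H n)).
rewrite Cmod_inv by apply H; rewrite Cmod_mult.
apply (Rmult_le_reg_r (Cmod (qpoch x q n) * Cmod (qpoch_inf (x * q ^ n) q)));
  [now apply Rmult_lt_0_compat|].
replace (/ Cmod (qpoch x q n) * (Cmod (qpoch x q n) * Cmod (qpoch_inf (x * q ^ n) q)))%R
  with (Cmod (qpoch_inf (x * q ^ n) q)) by (field; lra).
replace (qbound x / (Cmod (qpoch x q n) * Cmod (qpoch_inf (x * q ^ n) q)) *
   (Cmod (qpoch x q n) * Cmod (qpoch_inf (x * q ^ n) q)))%R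
  with (qbound x) by (field; lra).
apply Cmod_qpoch_inf_pow_le.
Qed.

End QPochhammer.

(** * Nonterminating q-Saalschutz *)

Lemma has_sum_CSeries (u : nat -> C) (l : C) : has_sum u l -> CSeries u = l.
Proof. intros H; apply CSeries_unique, has_sum_is_series, H. Qed.

Lemma geom_dominated_has_sum_CSeries (K r : R) (u : nat -> C) :
  geom_dominated K r u -> has_sum u (CSeries u).
Proof.
intros H; destruct (geom_dominated_summable _ _ _ H) as [l Hl].
now rewrite (has_sum_CSeries _ _ Hl).
Qed.

Lemma CSeries_ext (u v : nat -> C) : (forall n, u n = v n) -> CSeries u = CSeries v.
Proof.
intros H; unfold CSeries; f_equal; apply Series_ext; intros n; now rewrite H.
Qed.

Lemma Cmod_mult_le (x y : C) (K L : R) :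
  (Cmod x <= K)%R -> (Cmod y <= L)%R -> (Cmod (x * y) <= K * L)%R.
Proof. intros; rewrite Cmod_mult; apply Rmult_le_compat; auto using Cmod_ge_0. Qed.

Section Saalschutz.

Variable q : C.
Hypothesis hq : (Cmod q < 1)%R.

(* For the q-integral from [a] to [b] with poles at [1/e, 1/f, 1/g], one has
   [y = a/b] and [b1, b2, b3 = be, bf, bg]; the products (be, bf, bg; q)_oo and
   (ae, af, ag; q)_oo are cleared from the denominators. *)
Definition saal_term (y b1 b2 b3 : C) (m : nat) : C :=
  qpoch_inf (q * q ^ m) q * qpoch_inf (q / y * q ^ m) q *
  qpoch_inf (b1 * b2 * b3 * y * q ^ m) q *
  (qpoch b1 q m * qpoch b2 q m * qpoch b3 q m) * q ^ m.

Definition saal_half (y b1 b2 b3 : C) : C :=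
  qpoch_inf (b1 * y) q * qpoch_inf (b2 * y) q * qpoch_inf (b3 * y) q *
  CSeries (saal_term y b1 b2 b3).

Definition saal_bound (y b1 b2 b3 : C) : R :=
  (qbound q q * qbound q (q / y) * qbound q (b1 * b2 * b3 * y) *
   (qbound q b1 * qbound q b2 * qbound q b3))%R.

(** The bound is uniform in [i], as Tannery's theorem requires when b1 q^i -> 0. *)
Lemma saal_dominated_pow (y b1 b2 b3 : C) (i : nat) :
  geom_dominated (saal_bound y b1 b2 b3) (Cmod q) (saal_term y (b1 * q ^ i) b2 b3).
Proof.
split; [now apply Cmod_q_range|]; intros m; unfold saal_term, saal_bound.
rewrite <- Cmod_pow.
repeat apply Cmod_mult_le; try (now apply Cmod_qpoch_inf_pow_le);
  try (now apply Cmod_qpoch_le); try apply Rle_refl.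
- replace (b1 * q ^ i * b2 * b3 * y * q ^ m) with (b1 * b2 * b3 * y * q ^ (i + m))
    by (rewrite Cpow_add_r; ring).
  now apply Cmod_qpoch_inf_pow_le.
- eapply Rle_trans; [now apply Cmod_qpoch_le | now apply qbound_mult_pow].
Qed.

Lemma saal_dominated (y b1 b2 b3 : C) :
  geom_dominated (saal_bound y b1 b2 b3) (Cmod q) (saal_term y b1 b2 b3).
Proof.
pose proof (saal_dominated_pow y b1 b2 b3 0) as H.
now replace (b1 * q ^ 0) with b1 in H by (simpl; ring).
Qed.

Lemma saal_has_sum (y b1 b2 b3 : C) :
  has_sum (saal_term y b1 b2 b3) (CSeries (saal_term y b1 b2 b3)).
Proof. apply (geom_dominated_has_sum_CSeries _ _ _ (saal_dominated y b1 b2 b3)). Qed.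

(** A telescoping identity: the right-hand side is the antidifference of the combined term. The
    factor 1 - b1 y is what (b1 y; q)_oo has over (b1 q y; q)_oo in the two instances of
    [saal_half]. *)
Lemma saal_psum_step (y b1 b2 b3 : C) (m : nat) : y <> 0 ->
  (1 - b1 * y) * psum (saal_term y b1 b2 b3) (S m)
  - (1 - b1 * b2 * y) * (1 - b1 * b3 * y) * psum (saal_term y (b1 * q) b2 b3) (S m)
  = - (b1 * y) *
    (qpoch_inf (q * q ^ m) q * qpoch_inf (q / y * q ^ m) q *
     qpoch_inf (b1 * b2 * b3 * y * q * q ^ m) q *
     (qpoch (b1 * q) q m * qpoch b2 q (S m) * qpoch b3 q (S m))).
Proof.
intros hy.
assert (E0 : forall n, qpoch_inf (b1 * q * b2 * b3 * y * q ^ n) q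
                       = qpoch_inf (b1 * b2 * b3 * y * q * q ^ n) q)
  by (intros n; f_equal; ring).
assert (E1 : forall n, qpoch_inf (b1 * b2 * b3 * y * q ^ n) q
   = (1 - b1 * b2 * b3 * y * q ^ n) * qpoch_inf (b1 * b2 * b3 * y * q * q ^ n) q)
  by (intros n; rewrite qpoch_inf_step by assumption; do 2 f_equal; ring).
induction m as [|m IH].
- cbn [psum]; unfold saal_term; rewrite E0, E1; simpl; field; exact hy.
- assert (P1 : forall u n, psum u (S n) = psum u n + u n) by reflexivity.
  rewrite (P1 _ (S m)), (P1 _ (S m)).
  match goal with |- ?p * (?s + ?t) - ?r * (?s' + ?t') = ?R =>
    transitivity ((p * s - r * s') + (p * t - r * t')); [ring|] end.
  rewrite IH; unfold saal_term; rewrite E0, E1.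
  rewrite (qpoch_inf_step q hq (q * q ^ m)), (qpoch_inf_step q hq (q / y * q ^ m)).
  replace (q * q ^ m * q) with (q * q ^ S m) by (simpl; ring).
  replace (q / y * q ^ m * q) with (q / y * q ^ S m) by (simpl; field; exact hy).
  rewrite (qpoch_inf_step q hq (b1 * b2 * b3 * y * q * q ^ m)).
  replace (b1 * b2 * b3 * y * q * q ^ m * q)
    with (b1 * b2 * b3 * y * q * q ^ S m) by (simpl; ring).
  rewrite (qpoch_S_l q b1 m).
  rewrite (eq_refl : qpoch (b1 * q) q (S m) = qpoch (b1 * q) q m * (1 - b1 * q * q ^ m)).
  rewrite (eq_refl : qpoch b2 q (S (S m)) = qpoch b2 q (S m) * (1 - b2 * q ^ S m)).
  rewrite (eq_refl : qpoch b3 q (S (S m)) = qpoch b3 q (S m) * (1 - b3 * q ^ S m)).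
  rewrite (eq_refl : q ^ S m = q * q ^ m).
  set (X := q ^ m).
  generalize (qpoch_inf (q * (q * X)) q) (qpoch_inf (q / y * (q * X)) q)
    (qpoch_inf (b1 * b2 * b3 * y * q * (q * X)) q)
    (qpoch (b1 * q) q m) (qpoch b2 q (S m)) (qpoch b3 q (S m)).
  intros; field; exact hy.
Qed.

Lemma saal_half_step (y b1 b2 b3 : C) : y <> 0 ->
  saal_half y b1 b2 b3
  - (1 - b1 * b2 * y) * (1 - b1 * b3 * y) * saal_half y (b1 * q) b2 b3
  = - (b1 * y) *
    (qpoch_inf (b1 * q) q * qpoch_inf b2 q * qpoch_inf b3 q *
     (qpoch_inf (b1 * q * y) q * qpoch_inf (b2 * y) q * qpoch_inf (b3 * y) q)).
Proof.
intros hy.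
assert (L : (1 - b1 * y) * CSeries (saal_term y b1 b2 b3)
  - (1 - b1 * b2 * y) * (1 - b1 * b3 * y) * CSeries (saal_term y (b1 * q) b2 b3)
  = - (b1 * y) * (1 * 1 * 1 * (qpoch_inf (b1 * q) q * qpoch_inf b2 q * qpoch_inf b3 q))).
{ apply (cvg_unique (fun m =>
    (1 - b1 * y) * psum (saal_term y b1 b2 b3) (1 + m)%nat
    + - ((1 - b1 * b2 * y) * (1 - b1 * b3 * y)) * psum (saal_term y (b1 * q) b2 b3) (1 + m)%nat)).
  - match goal with |- cvg _ (?p * ?s - ?r * ?s') =>
      replace (p * s - r * s') with (p * s + - r * s') by ring end.
    apply cvg_plus; apply cvg_scal, (cvg_shift 1), saal_has_sum.
  - eapply cvg_ext.
    + intros m; symmetry; etransitivity; [|apply (saal_psum_step y b1 b2 b3 m hy)].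
      change (1 + m)%nat with (S m); ring.
    + apply cvg_scal.
      repeat apply cvg_mult;
        try (apply qpoch_inf_cvg_1; [assumption | now apply cvg_mult_pow]);
        try (now apply qpoch_cvg); apply (cvg_shift 1 (qpoch _ q)); now apply qpoch_cvg. }
unfold saal_half; rewrite (qpoch_inf_step q hq (b1 * y)).
replace (b1 * y * q) with (b1 * q * y) by ring.
match goal with |- ?A * ?B * ?C' * ?D * ?S - ?P * ?Q * (_ * ?S') = _ =>
  transitivity (B * C' * D * (A * S - P * Q * S')); [ring|] end.
rewrite L; ring.
Qed.

(** The q-integral with denominators cleared: exchanging its two ends a and b replaces y = a/b by
    1/y and each b_i by b_i y. *)
Definition saal_diff (y b1 b2 b3 : C) : C :=
  saal_half y b1 b2 b3 - y * saal_half (/ y) (b1 * y) (b2 * y) (b3 * y).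

(** The boundary term of [saal_half_step] is -b1 y times a product invariant under the exchange of
    the two ends. The other half produces -b1 times the same product, and its weight y makes the two
    cancel. *)
Lemma saal_diff_step (y b1 b2 b3 : C) : y <> 0 ->
  saal_diff y b1 b2 b3
  = (1 - b1 * b2 * y) * (1 - b1 * b3 * y) * saal_diff y (b1 * q) b2 b3.
Proof.
intros hy.
assert (hy' : / y <> 0) by (now apply Cinv_neq_0).
pose proof (saal_half_step y b1 b2 b3 hy) as H1.
pose proof (saal_half_step (/ y) (b1 * y) (b2 * y) (b3 * y) hy') as H2.
replace (b1 * y * (b2 * y) * / y) with (b1 * b2 * y) in H2 by (field; exact hy).
replace (b1 * y * (b3 * y) * / y) with (b1 * b3 * y) in H2 by (field; exact hy).
replace (b1 * y * / y) with b1 in H2 by (field; exact hy).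
replace (b2 * y * / y) with b2 in H2 by (field; exact hy).
replace (b3 * y * / y) with b3 in H2 by (field; exact hy).
replace (b1 * y * q * / y) with (b1 * q) in H2 by (field; exact hy).
replace (b1 * y * q) with (b1 * q * y) in H2 by ring.
unfold saal_diff.
match type of H1 with ?u - ?v = ?w => assert (K1 : u = v + w) by (rewrite <- H1; ring) end.
match type of H2 with ?u - ?v = ?w => assert (K2 : u = v + w) by (rewrite <- H2; ring) end.
rewrite K1, K2; ring.
Qed.

Lemma saal_half_cvg (y b1 b2 b3 : C) :
  cvg (fun i => saal_half y (b1 * q ^ i) b2 b3) (saal_half y 0 b2 b3).
Proof.
destruct (has_sum_tannery (saal_bound y b1 b2 b3) (Cmod q)
  (fun i => saal_term y (b1 * q ^ i) b2 b3) (saal_term y 0 b2 b3)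
  (fun i => CSeries (saal_term y (b1 * q ^ i) b2 b3))) as [l [H1 H2]].
- intros i; apply saal_dominated_pow.
- intros m; unfold saal_term.
  apply cvg_mult; [|apply cvg_const].
  apply cvg_mult.
  + apply cvg_mult; [apply cvg_const|].
    replace (0 * b2 * b3 * y * q ^ m) with (RtoC 0) by ring.
    rewrite qpoch_inf_0_l by assumption; apply qpoch_inf_cvg_1; [assumption|].
    apply (cvg_ext (fun i => (b2 * b3 * y * q ^ m * b1) * q ^ i)); [intros; ring|].
    now apply cvg_mult_pow.
  + do 2 (apply cvg_mult; [|apply cvg_const]).
    rewrite qpoch_0_l; apply qpoch_cvg_1; [assumption | now apply cvg_mult_pow].
- intros i; apply saal_has_sum.
- rewrite <- (has_sum_CSeries _ _ H1) in H2; unfold saal_half.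
  apply cvg_mult; [|exact H2].
  do 2 (apply cvg_mult; [|apply cvg_const]).
  replace (0 * y) with (RtoC 0) by ring; rewrite qpoch_inf_0_l by assumption.
  apply qpoch_inf_cvg_1; [assumption|].
  apply (cvg_ext (fun i => (b1 * y) * q ^ i)); [intros; ring | now apply cvg_mult_pow].
Qed.

Lemma saal_diff_limit (y b1 b2 b3 : C) : y <> 0 ->
  saal_diff y b1 b2 b3
  = qpoch_inf (b1 * b2 * y) q * qpoch_inf (b1 * b3 * y) q * saal_diff y 0 b2 b3.
Proof.
intros hy.
assert (E : forall i, saal_diff y b1 b2 b3
  = qpoch (b1 * b2 * y) q i * qpoch (b1 * b3 * y) q i * saal_diff y (b1 * q ^ i) b2 b3).
{ induction i as [|i IH].
  - simpl; replace (b1 * 1) with b1 by ring; ring.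
  - rewrite IH, (saal_diff_step y (b1 * q ^ i)) by exact hy; simpl.
    replace (b1 * q ^ i * q) with (b1 * (q * q ^ i)) by ring; ring. }
apply (cvg_unique (fun _ => saal_diff y b1 b2 b3)); [apply cvg_const|].
eapply cvg_ext; [intros i; symmetry; apply (E i)|].
apply cvg_mult; [apply cvg_mult; now apply qpoch_cvg|].
unfold saal_diff.
apply (cvg_ext (fun i => saal_half y (b1 * q ^ i) b2 b3
  + - y * saal_half (/ y) (b1 * y * q ^ i) (b2 * y) (b3 * y))).
- intros i; replace (b1 * q ^ i * y) with (b1 * y * q ^ i) by ring; ring.
- replace (saal_half y 0 b2 b3 - y * saal_half (/ y) (0 * y) (b2 * y) (b3 * y))
    with (saal_half y 0 b2 b3 + - y * saal_half (/ y) 0 (b2 * y) (b3 * y))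
    by (replace (0 * y) with (RtoC 0) by ring; ring).
  apply cvg_plus; [apply saal_half_cvg | apply cvg_scal, saal_half_cvg].
Qed.

Lemma saal_half_comm12 (y b1 b2 b3 : C) : saal_half y b1 b2 b3 = saal_half y b2 b1 b3.
Proof.
unfold saal_half; f_equal; [ring|]; apply CSeries_ext; intros m; unfold saal_term.
replace (b2 * b1 * b3 * y) with (b1 * b2 * b3 * y) by ring; ring.
Qed.

Lemma saal_half_comm13 (y b1 b2 b3 : C) : saal_half y b1 b2 b3 = saal_half y b3 b2 b1.
Proof.
unfold saal_half; f_equal; [ring|]; apply CSeries_ext; intros m; unfold saal_term.
replace (b3 * b2 * b1 * y) with (b1 * b2 * b3 * y) by ring; ring.
Qed.

(** By symmetry in the b_i, the limit b1 -> 0 can be repeated for b2 and b3. What remains depends on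
    y alone. *)
Lemma saal_diff_reduce (y b1 b2 b3 : C) : y <> 0 ->
  saal_diff y b1 b2 b3
  = qpoch_inf (b1 * b2 * y) q * qpoch_inf (b1 * b3 * y) q * qpoch_inf (b2 * b3 * y) q *
    saal_diff y 0 0 0.
Proof.
intros hy; rewrite saal_diff_limit by exact hy.
assert (E2 : saal_diff y 0 b2 b3 = saal_diff y b2 0 b3)
  by (unfold saal_diff; now rewrite saal_half_comm12, (saal_half_comm12 (/ y))).
assert (E3 : saal_diff y 0 0 b3 = saal_diff y b3 0 0)
  by (unfold saal_diff; now rewrite saal_half_comm13, (saal_half_comm13 (/ y))).
rewrite E2, saal_diff_limit, E3, saal_diff_limit by exact hy.
replace (b2 * 0 * y) with (RtoC 0) by ring; replace (b3 * 0 * y) with (RtoC 0) by ring.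
rewrite qpoch_inf_0_l by assumption; ring.
Qed.

Lemma has_sum_geom : has_sum (fun m => q ^ m) (/ (1 - q)).
Proof.
assert (h1 : 1 - q <> 0).
{ intros E; apply (qpoch_neq_0_of_lt_1 q hq q 1 hq); simpl; rewrite <- E; ring. }
apply (cvg_ext (fun n => / (1 - q) + - / (1 - q) * q ^ n)).
- intros n; induction n as [|n IH]; simpl; [ring|].
  rewrite <- IH; field; exact h1.
- replace (/ (1 - q)) with (/ (1 - q) + - / (1 - q) * 0) at 1 by ring.
  apply cvg_plus; [apply cvg_const | apply cvg_scal, cvg_geom, hq].
Qed.

(** The factorials (q/y; q)_m and (q; q)_m complete the tails (q/y q^m; q)_oo and (q q^m; q)_oo to
    products free of m. *)
Lemma saal_term_base (y : C) (m : nat) :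
  saal_term y 0 (q / y) q m = qpoch_inf q q * qpoch_inf (q / y) q * q ^ m.
Proof.
unfold saal_term.
rewrite (qpoch_inf_split q hq q m), (qpoch_inf_split q hq (q / y) m), qpoch_0_l.
replace (0 * (q / y) * q * y * q ^ m) with (RtoC 0) by ring.
rewrite qpoch_inf_0_l by assumption; ring.
Qed.

Lemma saal_half_base (y : C) : y <> 0 ->
  saal_half y 0 (q / y) q
  = qpoch_inf q q * qpoch_inf (q * y) q * (qpoch_inf q q * qpoch_inf (q / y) q) * / (1 - q).
Proof.
intros hy; unfold saal_half.
rewrite (has_sum_CSeries (saal_term y 0 (q / y) q)
  (qpoch_inf q q * qpoch_inf (q / y) q * / (1 - q))).
- replace (0 * y) with (RtoC 0) by ring; replace (q / y * y) with q by (field; exact hy).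
  rewrite qpoch_inf_0_l by assumption; ring.
- eapply has_sum_ext; [intros m; symmetry; apply saal_term_base|].
  apply has_sum_scal, has_sum_geom.
Qed.

(* The constant [saal_diff y 0 0 0] is found by taking [b2 = q / y], [b3 = q],
   where both series are geometric. *)
Lemma saal_diff_eval (y b1 b2 b3 : C) : y <> 0 ->
  saal_diff y b1 b2 b3
  = qpoch_inf q q * qpoch_inf y q * qpoch_inf (q / y) q *
    (qpoch_inf (b1 * b2 * y) q * qpoch_inf (b1 * b3 * y) q * qpoch_inf (b2 * b3 * y) q).
Proof.
intros hy; rewrite saal_diff_reduce by exact hy.
assert (h1 : 1 - q <> 0).
{ intros E; apply (qpoch_neq_0_of_lt_1 q hq q 1 hq); simpl; rewrite <- E; ring. }
assert (hy' : / y <> 0) by (now apply Cinv_neq_0).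
assert (hqq : qpoch_inf (q * q) q <> 0).
{ intros E; apply (qpoch_inf_neq_0_of_lt_1 q hq q hq).
  rewrite qpoch_inf_step, E by assumption; ring. }
assert (E : saal_diff y 0 0 0 = qpoch_inf q q * qpoch_inf y q * qpoch_inf (q / y) q).
{ pose proof (saal_diff_reduce y 0 (q / y) q hy) as H.
  replace (0 * (q / y) * y) with (RtoC 0) in H by ring.
  replace (0 * q * y) with (RtoC 0) in H by ring.
  replace (q / y * q * y) with (q * q) in H by (field; exact hy).
  rewrite qpoch_inf_0_l in H by assumption.
  unfold saal_diff at 1 in H; rewrite saal_half_base in H by exact hy.
  assert (E2 : saal_half (/ y) (0 * y) (q / y * y) (q * y)
     = qpoch_inf q q * qpoch_inf (q / y) q * (qpoch_inf q q * qpoch_inf (q * y) q) * / (1 - q)).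
  { replace (0 * y) with (RtoC 0) by ring.
    replace (q / y * y) with q by (field; exact hy).
    (* The three transpositions turn (0, q, qy) into (0, qy, q), which is the base case for 1/y
       since q/(1/y) = qy. *)
    rewrite saal_half_comm12, saal_half_comm13, saal_half_comm12.
    replace (q * y) with (q / / y) by (field; exact hy).
    rewrite saal_half_base by exact hy'.
    unfold Cdiv; ring. }
  rewrite E2 in H.
  rewrite (qpoch_inf_step q hq y).
  apply (Cmult_cancel_l (qpoch_inf (q * q) q)); [exact hqq|].
  transitivity (1 * 1 * qpoch_inf (q * q) q * saal_diff y 0 0 0); [ring|].
  rewrite <- H; rewrite (qpoch_inf_step q hq q).
  replace (y * q) with (q * y) by ring; field; exact h1. }
rewrite E; ring.
Qed.

End Saalschutz.

(** * The nonterminating 6phi5 sum *)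

Section WellPoised.

Variable q : C.
Hypothesis hq : (Cmod q < 1)%R.

(* [(1 - alpha q^(2n)) (alpha; q)_n / (1 - alpha)], as a polynomial in
   [A = alpha q]. *)
Definition vwp (A : C) (n : nat) : C :=
  match n with
  | O => 1
  | S m => qpoch A q m * (1 - A * q ^ (2 * m + 1))
  end.

(** This is s^n (b/s; q)_n, as a polynomial in s; at s = 0 it is (-b)^n q^(n(n-1)/2). *)
Fixpoint shifted_prod (b s : C) (n : nat) : C :=
  match n with
  | O => 1
  | S m => shifted_prod b s m * (s - b * q ^ m)
  end.

(** Every factor sq - b q^i with i > 0 is q times a factor of the product at s. Hence the terms of
    the series at s and at sq have [shifted_prod b s n] in common. *)
Lemma shifted_prod_mult_q (b s : C) (n : nat) :
  shifted_prod b (s * q) (S n) = (s * q - b) * q ^ n * shifted_prod b s n.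
Proof.
induction n as [|n IH]; [simpl; ring|].
change (shifted_prod b (s * q) (S (S n)))
  with (shifted_prod b (s * q) (S n) * (s * q - b * q ^ S n)).
rewrite IH; simpl; ring.
Qed.

Lemma shifted_prod_root (b : C) (m n : nat) : (m < n)%nat -> shifted_prod b (b * q ^ m) n = 0.
Proof.
induction n as [|n IH]; intros h; [lia|]; simpl.
destruct (Nat.eq_dec m n) as [->|hne]; [ring | rewrite IH by lia; ring].
Qed.

(* Arguments at which [shifted_prod b s n] is O(r^n), uniformly in [m]. *)
Definition admissible (b : C) (r : R) (s : C) : Prop :=
  (Cmod s <= r)%R \/ exists m, s = b * q ^ m.

Lemma admissible_mult_q (b : C) (r : R) (s : C) : admissible b r s -> admissible b r (s * q).
Proof.
intros [H|[m ->]].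
- left; rewrite Cmod_mult; pose proof (Cmod_ge_0 s); pose proof (Cmod_ge_0 q); nra.
- right; exists (S m); simpl; ring.
Qed.

Definition prod_bound (b : C) (r : R) : R := exp (2 * Cmod b / r / (1 - Cmod q)).

(** The factor of index n is at most r + 2|b||q|^n = r (1 + (2|b|/r)|q|^n). For |s| <= r this is the
    triangle inequality. For s = b q^m, either m < n and the product already vanishes, or |s| <=
    |b||q|^n, whence the 2. *)
Lemma shifted_prod_le (b : C) (r : R) (s : C) (n : nat) : (0 < r < 1)%R -> admissible b r s ->
  (Cmod (shifted_prod b s n) <= prod_bound b r * r ^ n)%R.
Proof.
intros hr hs.
assert (hc : (0 <= 2 * Cmod b / r)%R)
  by (apply Rdiv_le_0_compat; [pose proof (Cmod_ge_0 b); lra | lra]).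
assert (A : (Cmod (shifted_prod b s n) <= r ^ n * rprod (2 * Cmod b / r) (Cmod q) n)%R).
{ induction n as [|n IH]; [simpl; rewrite Cmod_1; lra|].
  assert (hR : (0 <= r ^ n * rprod (2 * Cmod b / r) (Cmod q) n)%R).
  { apply Rmult_le_pos; [apply pow_le; lra|].
    pose proof (rprod_ge_1 _ _ n hc (Cmod_ge_0 q)); lra. }
  assert (E : (r ^ S n * rprod (2 * Cmod b / r) (Cmod q) (S n)
     = (r ^ n * rprod (2 * Cmod b / r) (Cmod q) n) * (r + 2 * Cmod b * Cmod q ^ n))%R)
    by (simpl; field; lra).
  assert (hp : (0 <= Cmod q ^ n)%R) by (apply pow_le, Cmod_ge_0).
  pose proof (Cmod_ge_0 b) as hb.
  rewrite E; simpl; destruct hs as [hs|[m ->]].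
  - apply Cmod_mult_le; [exact IH|].
    eapply Rle_trans; [apply Cmod_triangle_minus|].
    rewrite Cmod_mult, Cmod_pow; nra.
  - destruct (Nat.lt_ge_cases m n) as [h|h].
    + rewrite shifted_prod_root by exact h.
      replace (0 * (b * q ^ m - b * q ^ n)) with (RtoC 0) by ring; rewrite Cmod_0.
      apply Rmult_le_pos; [exact hR | nra].
    + apply Cmod_mult_le; [exact IH|].
      eapply Rle_trans; [apply Cmod_triangle_minus|].
      rewrite !Cmod_mult, !Cmod_pow.
      assert (hm : (Cmod q ^ m <= Cmod q ^ n)%R).
      { replace m with (n + (m - n))%nat by lia; rewrite pow_add.
        pose proof (Cmod_q_pow_le q hq (m - n)); rewrite Cmod_pow in H; nra. }
      nra. }
eapply Rle_trans; [exact A|]; rewrite Rmult_comm.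
apply Rmult_le_compat_r; [apply pow_le; lra|].
apply rprod_le; [exact hc | now apply Cmod_q_range].
Qed.

Lemma vwp_le (A : C) (n : nat) : (Cmod (vwp A n) <= qbound q A * (1 + Cmod A))%R.
Proof.
pose proof (qbound_ge_1 q hq A); pose proof (Cmod_ge_0 A).
destruct n as [|n]; simpl; [rewrite Cmod_1; nra|].
apply Cmod_mult_le; [now apply Cmod_qpoch_le|].
eapply Rle_trans; [apply Cmod_triangle_minus|].
rewrite Cmod_1, Cmod_mult.
pose proof (Cmod_q_pow_le q hq (n + (n + 0) + 1)).
pose proof (Cmod_ge_0 (q ^ (n + (n + 0) + 1))); nra.
Qed.

Lemma qpoch_q_neq_0 (n : nat) : qpoch q q n <> 0.
Proof. now apply qpoch_neq_0_of_lt_1. Qed.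

Lemma qpoch_neq_0_factor (x : C) (n : nat) :
  (forall k, qpoch x q k <> 0) -> 1 - x * q ^ n <> 0.
Proof. intros H E; apply (H (S n)); simpl; rewrite E; ring. Qed.

Section SixPhiFive.

Variables b c d : C.
Hypothesis hbc : forall n, qpoch (b * c) q n <> 0.
Hypothesis hbd : forall n, qpoch (b * d) q n <> 0.

Definition six_coef (n : nat) : C :=
  vwp (b * c * d) n * qpoch c q n * qpoch d q n *
  (/ qpoch q q n * / qpoch (b * c) q n * / qpoch (b * d) q n).

(** (cds; q)_oo times the term of the 6phi5 with alpha = bcd/q, free numerator parameters b/s, c, d
    and argument s. The infinite product absorbs the denominator (cds; q)_n. *)
Definition six_term (s : C) (n : nat) : C :=
  six_coef n * shifted_prod b s n * qpoch_inf (c * d * s * q ^ n) q.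

Lemma six_coef_bounded : exists K, forall n, (Cmod (six_coef n) <= K)%R.
Proof.
destruct (qpoch_inv_bounded q hq q qpoch_q_neq_0) as [K1 H1].
destruct (qpoch_inv_bounded q hq _ hbc) as [K2 H2].
destruct (qpoch_inv_bounded q hq _ hbd) as [K3 H3].
eexists; intros n; unfold six_coef.
repeat apply Cmod_mult_le; try apply vwp_le; try (now apply Cmod_qpoch_le);
  [apply H1 | apply H2 | apply H3].
Qed.

Lemma six_term_dominated (r : R) : (0 < r < 1)%R -> exists K, forall s L,
  admissible b r s -> (qbound q (c * d * s) <= L)%R -> geom_dominated (K * L) r (six_term s).
Proof.
intros hr; destruct six_coef_bounded as [K HK].
exists (K * prod_bound b r)%R; intros s L hs hL; split; [lra|]; intros n; unfold six_term.
replace (K * prod_bound b r * L * r ^ n)%R with (K * (prod_bound b r * r ^ n) * L)%R by ring.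
repeat apply Cmod_mult_le; [apply HK | now apply shifted_prod_le|].
eapply Rle_trans; [now apply Cmod_qpoch_inf_pow_le | exact hL].
Qed.

Lemma six_has_sum (r : R) (s : C) : (0 < r < 1)%R -> admissible b r s ->
  has_sum (six_term s) (CSeries (six_term s)).
Proof.
intros hr hs; destruct (six_term_dominated r hr) as [K HK].
eapply geom_dominated_has_sum_CSeries, HK; [exact hs | apply Rle_refl].
Qed.

(** Again a telescoping identity, now for the recurrence s -> sq with b, c, d fixed. [six_step]
    follows because the boundary term contains [shifted_prod], which is O(r^m) at admissible s. *)
Lemma six_psum_step (s : C) (m : nat) :
  (1 - s) * psum (six_term s) (S m)
  - (1 - c * s) * (1 - d * s) * psum (six_term (s * q)) (S m)
  = - s * (qpoch (b * c * d) q m * qpoch c q (S m) * qpoch d q (S m) *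
      (/ qpoch q q m * / qpoch (b * c) q m * / qpoch (b * d) q m)) *
    shifted_prod b s m * qpoch_inf (c * d * s * q * q ^ m) q.
Proof.
assert (E0 : forall n, qpoch_inf (c * d * (s * q) * q ^ n) q
                       = qpoch_inf (c * d * s * q * q ^ n) q)
  by (intros n; f_equal; ring).
assert (E1 : forall n, qpoch_inf (c * d * s * q ^ n) q
   = (1 - c * d * s * q ^ n) * qpoch_inf (c * d * s * q * q ^ n) q)
  by (intros n; rewrite qpoch_inf_step by assumption; do 2 f_equal; ring).
induction m as [|m IH].
- cbn [psum]; unfold six_term, six_coef; rewrite E0, E1; simpl; field; exact C1_nz.
- assert (P1 : forall u n, psum u (S n) = psum u n + u n) by reflexivity.
  rewrite (P1 _ (S m)), (P1 _ (S m)).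
  match goal with |- ?p * (?x + ?t) - ?r * (?x' + ?t') = ?R =>
    transitivity ((p * x - r * x') + (p * t - r * t')); [ring|] end.
  rewrite IH; unfold six_term, six_coef; rewrite E0, E1, shifted_prod_mult_q.
  rewrite (qpoch_inf_step q hq (c * d * s * q * q ^ m)).
  replace (c * d * s * q * q ^ m * q) with (c * d * s * q * q ^ S m) by (simpl; ring).
  assert (hS : forall x n, qpoch x q (S n) = qpoch x q n * (1 - x * q ^ n)) by reflexivity.
  rewrite (hS c (S m)), (hS d (S m)), (hS q m), (hS (b * c) m), (hS (b * d) m),
    (hS (b * c * d) m).
  change (vwp (b * c * d) (S m))
    with (qpoch (b * c * d) q m * (1 - b * c * d * q ^ (2 * m + 1))).
  change (shifted_prod b s (S m)) with (shifted_prod b s m * (s - b * q ^ m)).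
  replace (q ^ (2 * m + 1)) with (q * q ^ m * q ^ m)
    by (rewrite Nat.add_1_r; simpl; rewrite Nat.add_0_r, Cpow_add_r; ring).
  pose proof (qpoch_q_neq_0 m); pose proof (hbc m); pose proof (hbd m).
  pose proof (qpoch_neq_0_factor _ m qpoch_q_neq_0).
  pose proof (qpoch_neq_0_factor _ m hbc); pose proof (qpoch_neq_0_factor _ m hbd).
  rewrite (eq_refl : q ^ S m = q * q ^ m).
  set (X := q ^ m) in *.
  revert H H0 H1; generalize (qpoch q q m) (qpoch (b * c) q m) (qpoch (b * d) q m)
    (qpoch_inf (c * d * s * q * (q * X)) q) (qpoch (b * c * d) q m)
    (qpoch c q (S m)) (qpoch d q (S m)) (shifted_prod b s m).
  intros; field; repeat split; assumption.
Qed.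

Lemma six_step (r : R) (s : C) : (0 < r < 1)%R -> admissible b r s ->
  (1 - s) * CSeries (six_term s)
  = (1 - c * s) * (1 - d * s) * CSeries (six_term (s * q)).
Proof.
intros hr hs.
assert (L : (1 - s) * CSeries (six_term s)
   + - ((1 - c * s) * (1 - d * s)) * CSeries (six_term (s * q)) = 0).
{ apply (cvg_unique (fun m => (1 - s) * psum (six_term s) (1 + m)%nat
    + - ((1 - c * s) * (1 - d * s)) * psum (six_term (s * q)) (1 + m)%nat)).
  - apply cvg_plus; apply cvg_scal, (cvg_shift 1); apply (six_has_sum r); auto using admissible_mult_q.
  - destruct (qpoch_inv_bounded q hq q qpoch_q_neq_0) as [K1 H1].
    destruct (qpoch_inv_bounded q hq _ hbc) as [K2 H2].
    destruct (qpoch_inv_bounded q hq _ hbd) as [K3 H3].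
    set (K := (Cmod (- s) * (qbound q (b * c * d) * qbound q c * qbound q d * (K1 * K2 * K3)) *
               prod_bound b r * qbound q (c * d * s * q))%R).
    apply (cvg_squeeze _ _ (fun m => K * r ^ m)%R); [|apply is_lim_geom_scal; lra].
    intros m; cbv beta; change (1 + m)%nat with (S m).
    match goal with |- (Cmod (?p * ?x + - ?w * ?z - ?o) <= _)%R =>
      replace (p * x + - w * z - o) with (p * x - w * z) by ring end.
    rewrite six_psum_step.
    replace (K * r ^ m)%R with
      (Cmod (- s) * (qbound q (b * c * d) * qbound q c * qbound q d * (K1 * K2 * K3)) *
       (prod_bound b r * r ^ m) * qbound q (c * d * s * q))%R by (unfold K; ring).
    repeat apply Cmod_mult_le; try (now apply Cmod_qpoch_le); try apply Rle_refl;
      [apply H1 | apply H2 | apply H3 | now apply shifted_prod_le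
      | now apply Cmod_qpoch_inf_pow_le]. }
match type of L with ?u + - ?v * ?w = _ =>
  replace u with ((u + - v * w) + v * w) by ring; rewrite L; ring end.
Qed.

Lemma six_iter (r : R) (s : C) (i : nat) : (0 < r < 1)%R -> admissible b r s ->
  qpoch s q i * CSeries (six_term s)
  = qpoch (c * s) q i * qpoch (d * s) q i * CSeries (six_term (s * q ^ i)).
Proof.
intros hr hs.
assert (G : admissible b r (s * q ^ i) /\ qpoch s q i * CSeries (six_term s)
  = qpoch (c * s) q i * qpoch (d * s) q i * CSeries (six_term (s * q ^ i))); [|apply G].
induction i as [|i [G IH]].
- simpl; replace (s * 1) with s by ring; split; [exact hs | ring].
- simpl; replace (s * (q * q ^ i)) with (s * q ^ i * q) by ring.
  split; [now apply admissible_mult_q|].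
  transitivity ((1 - s * q ^ i) * (qpoch s q i * CSeries (six_term s))); [ring|].
  rewrite IH.
  transitivity (qpoch (c * s) q i * qpoch (d * s) q i *
    ((1 - s * q ^ i) * CSeries (six_term (s * q ^ i)))); [ring|].
  rewrite (six_step r _ hr G); ring.
Qed.

Lemma six_limit (s : C) : (Cmod s < 1)%R ->
  qpoch_inf s q * CSeries (six_term s)
  = qpoch_inf (c * s) q * qpoch_inf (d * s) q * CSeries (six_term 0).
Proof.
(* A midpoint, so that r lies above |s|, below 1, and is positive even for s = 0. *)
intros hs; set (r := ((1 + Cmod s) / 2)%R).
pose proof (Cmod_ge_0 s) as hs0.
assert (hr : (0 < r < 1)%R) by (unfold r; lra).
assert (G : forall i, (Cmod (s * q ^ i) <= Cmod s)%R).
{ intros i; rewrite Cmod_mult; pose proof (Cmod_q_pow_le q hq i); nra. }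
assert (G' : forall i, admissible b r (s * q ^ i))
  by (intros i; left; specialize (G i); unfold r; lra).
destruct (six_term_dominated r hr) as [K HK].
destruct (has_sum_tannery (K * qbound q (c * d * s)) r
  (fun i => six_term (s * q ^ i)) (six_term 0)
  (fun i => CSeries (six_term (s * q ^ i)))) as [l [H1 H2]].
- intros i; apply HK; [apply G'|].
  apply qbound_incr; [assumption|]; rewrite !(Cmod_mult (c * d)).
  apply Rmult_le_compat_l; [apply Cmod_ge_0 | apply G].
- intros n; unfold six_term.
  apply cvg_mult; [apply cvg_mult; [apply cvg_const|]|].
  + induction n as [|n IH]; simpl; [apply cvg_const|].
    apply cvg_mult; [exact IH|].
    apply cvg_plus; [now apply cvg_mult_pow | apply cvg_const].
  + replace (c * d * 0 * q ^ n) with (RtoC 0) by ring.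
    rewrite qpoch_inf_0_l by assumption; apply qpoch_inf_cvg_1; [assumption|].
    apply (cvg_ext (fun i => (c * d * s * q ^ n) * q ^ i)); [intros; ring|].
    now apply cvg_mult_pow.
- intros i; apply (six_has_sum r); [exact hr | apply G'].
- rewrite <- (has_sum_CSeries _ _ H1) in H2.
  apply (cvg_unique (fun i => qpoch s q i * CSeries (six_term s))).
  + apply cvg_mult; [now apply qpoch_cvg | apply cvg_const].
  + eapply cvg_ext; [intros i; symmetry; apply (six_iter r)|].
    * exact hr.
    * specialize (G' O); now replace (s * q ^ 0) with s in G' by (simpl; ring).
    * apply cvg_mult; [apply cvg_mult; now apply qpoch_cvg | exact H2].
Qed.

(** The elementary case: at s = b every term with n > 0 contains the factor s - b. *)
Lemma six_at_b : CSeries (six_term b) = qpoch_inf (b * c * d) q.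
Proof.
apply has_sum_CSeries.
replace (qpoch_inf (b * c * d) q) with (psum (six_term b) 1).
- apply has_sum_finite; intros k hk; unfold six_term.
  replace b with (b * q ^ 0) at 2 by (simpl; ring).
  rewrite shifted_prod_root by lia; ring.
- simpl; unfold six_term, six_coef; simpl.
  replace (c * d * b * 1) with (b * c * d) by ring; field; exact C1_nz.
Qed.

(** The recurrence is iterated from s = b. No bound on |b| is available, but b q^m is admissible for
    any radius; 1/2 is an arbitrary choice. *)
Lemma six_at_b_pow (m : nat) :
  qpoch_inf (b * c) q * qpoch_inf (b * d) q * CSeries (six_term (b * q ^ m))
  = qpoch b q m * qpoch_inf (b * c * d) q *
    (qpoch_inf (b * c * q ^ m) q * qpoch_inf (b * d * q ^ m) q).
Proof.
pose proof (six_iter (1 / 2) b m ltac:(lra)) as H.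
rewrite six_at_b in H; rewrite H.
- replace (c * b) with (b * c) by ring; replace (d * b) with (b * d) by ring.
  rewrite (qpoch_inf_split q hq (b * c) m), (qpoch_inf_split q hq (b * d) m); ring.
- right; exists O; simpl; ring.
Qed.

(** For m with |b q^m| < 1 the series at b q^m is known twice: from [six_at_b_pow], and from
    [six_limit] in terms of its value at 0. Comparison gives that value, without assuming |b| <
    1. *)
Lemma six_at_0 :
  qpoch_inf (b * c) q * qpoch_inf (b * d) q * CSeries (six_term 0)
  = qpoch_inf b q * qpoch_inf (b * c * d) q.
Proof.
destruct (cvg_mult_pow q hq b 1%R) as [m Hm]; [lra|].
specialize (Hm m (le_n _)); replace (b * q ^ m - 0) with (b * q ^ m) in Hm by ring.
pose proof (six_limit _ Hm) as H.
pose proof (six_at_b_pow m) as H'.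
rewrite (qpoch_inf_split q hq b m).
assert (h1 : qpoch_inf (b * c * q ^ m) q <> 0).
{ intros E; apply (qpoch_inf_neq_0 q hq _ hbc); rewrite (qpoch_inf_split q hq _ m), E; ring. }
assert (h2 : qpoch_inf (b * d * q ^ m) q <> 0).
{ intros E; apply (qpoch_inf_neq_0 q hq _ hbd); rewrite (qpoch_inf_split q hq _ m), E; ring. }
replace (c * (b * q ^ m)) with (b * c * q ^ m) in H by ring.
replace (d * (b * q ^ m)) with (b * d * q ^ m) in H by ring.
apply (Cmult_cancel_l (qpoch_inf (b * c * q ^ m) q * qpoch_inf (b * d * q ^ m) q));
  [now apply Cmult_neq_0|].
transitivity (qpoch_inf (b * c) q * qpoch_inf (b * d) q *
  (qpoch_inf (b * c * q ^ m) q * qpoch_inf (b * d * q ^ m) q * CSeries (six_term 0))); [ring|].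
rewrite <- H.
transitivity (qpoch_inf (b * q ^ m) q *
  (qpoch_inf (b * c) q * qpoch_inf (b * d) q * CSeries (six_term (b * q ^ m)))); [ring|].
rewrite H'; ring.
Qed.

Lemma six_eval (s : C) : (Cmod s < 1)%R ->
  qpoch_inf (b * c) q * qpoch_inf (b * d) q * (qpoch_inf s q * CSeries (six_term s))
  = qpoch_inf (c * s) q * qpoch_inf (d * s) q * (qpoch_inf b q * qpoch_inf (b * c * d) q).
Proof. intros hs; rewrite six_limit, <- six_at_0 by exact hs; ring. Qed.

End SixPhiFive.

End WellPoised.

(** * Nonterminating Watson *)

Section NonterminatingWatson.

Variable q : C.
Hypothesis hq0 : q <> 0.
Hypothesis hq : (Cmod q < 1)%R.

Fixpoint shift_sign (b : C) (n : nat) : C :=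
  match n with
  | O => 1
  | S m => shift_sign b m * - (b * q ^ m)
  end.

(** Pulling -q^i out of each w - q^i leaves 1 - w q^(-i), and these factors extend (wq; q)_oo
    downwards by n places. This converts a 6phi5 factor into the tail of a shifted 3phi2. *)
Lemma shifted_prod_qpoch_inf (b w : C) (n : nat) :
  shifted_prod q b (b * w) n * qpoch_inf (w * q) q
  = shift_sign b n * qpoch_inf (w * q / q ^ n) q.
Proof.
induction n as [|n IH]; simpl.
- do 2 f_equal; field; exact C1_nz.
- pose proof (Cpow_nz q n hq0) as hn.
  rewrite (qpoch_inf_step q hq (w * q / (q * q ^ n))).
  replace (w * q / (q * q ^ n) * q) with (w * q / q ^ n) by (field; auto).
  transitivity ((shifted_prod q b (b * w) n * qpoch_inf (w * q) q) * (b * w - b * q ^ n));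
    [ring|].
  rewrite IH; field; auto.
Qed.

(** Quasi-periodicity of the theta function (y, q/y; q)_oo under y -> y q^(-n). The powers
    q^(n(n-1)/2) cancel, and (by)^n, the power of the argument of the 8W7, remains. *)
Lemma shift_sign_theta (b y : C) (n : nat) : y <> 0 ->
  shift_sign b n * q ^ n * (qpoch_inf (y / q ^ n) q * qpoch_inf (q / (y / q ^ n)) q)
  = (b * y) ^ n * (qpoch_inf y q * qpoch_inf (q / y) q).
Proof.
intros hy; induction n as [|n IH].
- simpl; replace (y / 1) with y by (field; exact C1_nz); ring.
- pose proof (Cpow_nz q n hq0) as hn.
  transitivity (b * y * ((b * y) ^ n * (qpoch_inf y q * qpoch_inf (q / y) q)));
    [|simpl; ring].
  rewrite <- IH.
  rewrite (qpoch_inf_step q hq (y / q ^ S n)), (qpoch_inf_step q hq (q / (y / q ^ n))).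
  simpl.
  replace (y / (q * q ^ n) * q) with (y / q ^ n) by (field; auto).
  replace (q / (y / (q * q ^ n))) with (q / (y / q ^ n) * q) by (field; auto).
  field; auto.
Qed.

(** Up to the factor (q, q/y, bc, bd; q)_oo, the term of a 4phi3 with numerators b1, b2, b3, b and
    denominators q/y, bc, bd; it is balanced when bcd = b1 b2 b3 y. *)
Definition watson_term (y b1 b2 b3 b c d : C) (m : nat) : C :=
  qpoch_inf (q * q ^ m) q * qpoch_inf (q / y * q ^ m) q *
  qpoch_inf (b * c * q ^ m) q * qpoch_inf (b * d * q ^ m) q *
  (qpoch b1 q m * qpoch b2 q m * qpoch b3 q m * qpoch b q m) * q ^ m.

Definition watson_half (y b1 b2 b3 b c d : C) : C :=
  qpoch_inf (b1 * y) q * qpoch_inf (b2 * y) q * qpoch_inf (b3 * y) q *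
  qpoch_inf (b * y) q * CSeries (watson_term y b1 b2 b3 b c d).

(** An 8W7 term with A = alpha q. The denominator parameters are independent arguments instead of
    quotients A/b_i, so that a b_i may be 0. *)
Definition vwp_series_term (A b1 b2 b3 b4 b5 c1 c2 c3 c4 c5 z : C) (n : nat) : C :=
  vwp q A n *
  (qpoch b1 q n * qpoch b2 q n * qpoch b3 q n * qpoch b4 q n * qpoch b5 q n) *
  (/ qpoch q q n * / qpoch c1 q n * / qpoch c2 q n * / qpoch c3 q n * / qpoch c4 q n *
   / qpoch c5 q n) * z ^ n.

Lemma watson_has_sum (y b1 b2 b3 b c d : C) :
  has_sum (watson_term y b1 b2 b3 b c d) (CSeries (watson_term y b1 b2 b3 b c d)).
Proof.
eapply (geom_dominated_has_sum_CSeries _ (Cmod q)); split; [now apply Cmod_q_range|].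
intros m; unfold watson_term; rewrite <- Cmod_pow.
repeat apply Cmod_mult_le; try (now apply Cmod_qpoch_inf_pow_le);
  try (now apply Cmod_qpoch_le); apply Rle_refl.
Qed.

Lemma vwp_series_dominated (A b1 b2 b3 b4 b5 c1 c2 c3 c4 c5 z : C) :
  (forall n, qpoch c1 q n <> 0) -> (forall n, qpoch c2 q n <> 0) ->
  (forall n, qpoch c3 q n <> 0) -> (forall n, qpoch c4 q n <> 0) ->
  (forall n, qpoch c5 q n <> 0) -> (Cmod z < 1)%R ->
  exists K, geom_dominated K (Cmod z) (vwp_series_term A b1 b2 b3 b4 b5 c1 c2 c3 c4 c5 z).
Proof.
intros h1 h2 h3 h4 h5 hz.
destruct (qpoch_inv_bounded q hq q (qpoch_q_neq_0 q hq)) as [K0 H0].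
destruct (qpoch_inv_bounded q hq _ h1) as [K1 H1].
destruct (qpoch_inv_bounded q hq _ h2) as [K2 H2].
destruct (qpoch_inv_bounded q hq _ h3) as [K3 H3].
destruct (qpoch_inv_bounded q hq _ h4) as [K4 H4].
destruct (qpoch_inv_bounded q hq _ h5) as [K5 H5].
eexists; split; [split; [apply Cmod_ge_0 | exact hz]|].
intros n; unfold vwp_series_term; rewrite <- Cmod_pow.
repeat apply Cmod_mult_le; try (now apply Cmod_qpoch_le);
  [now apply vwp_le | apply H0 | apply H1 | apply H2 | apply H3 | apply H4 | apply H5
  | apply Rle_refl].
Qed.

Lemma vwp_series_has_sum (A b1 b2 b3 b4 b5 c1 c2 c3 c4 c5 z : C) :
  (forall n, qpoch c1 q n <> 0) -> (forall n, qpoch c2 q n <> 0) ->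
  (forall n, qpoch c3 q n <> 0) -> (forall n, qpoch c4 q n <> 0) ->
  (forall n, qpoch c5 q n <> 0) -> (Cmod z < 1)%R ->
  has_sum (vwp_series_term A b1 b2 b3 b4 b5 c1 c2 c3 c4 c5 z)
    (CSeries (vwp_series_term A b1 b2 b3 b4 b5 c1 c2 c3 c4 c5 z)).
Proof.
intros h1 h2 h3 h4 h5 hz.
destruct (vwp_series_dominated A b1 b2 b3 b4 b5 c1 c2 c3 c4 c5 z) as [K HK]; auto.
exact (geom_dominated_has_sum_CSeries _ _ _ HK).
Qed.

Section Expansion.

Variables y b1 b2 b3 b c d : C.
Hypothesis hy : y <> 0.
Hypothesis hbal : b * c * d = b1 * b2 * b3 * y.
Hypothesis hz : (Cmod (b * y) < 1)%R.
Hypothesis hbc : forall n, qpoch (b * c) q n <> 0.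
Hypothesis hbd : forall n, qpoch (b * d) q n <> 0.

Let coef := six_coef q b c d.
Let term := six_term q b c d.

(** In [pair1] and [pair2], fixing m and summing over n gives a 6phi5, and fixing n and summing over
    m gives a shifted 3phi2. *)
Let pair1 (n m : nat) : C :=
  qpoch_inf (q * q ^ m) q * qpoch_inf (q / y * q ^ m) q *
  (qpoch b1 q m * qpoch b2 q m * qpoch b3 q m) * q ^ m * term (b * q ^ m) n.

Let pair2 (n m : nat) : C :=
  qpoch_inf (q * q ^ m) q * qpoch_inf (q / / y * q ^ m) q *
  (qpoch (b1 * y) q m * qpoch (b2 * y) q m * qpoch (b3 * y) q m) * q ^ m *
  term (b * y * q ^ m) n.

Let row1 (n : nat) : C :=
  coef n * shift_sign b n * q ^ n * (qpoch b1 q n * qpoch b2 q n * qpoch b3 q n) *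
  CSeries (saal_term q (y / q ^ n) (b1 * q ^ n) (b2 * q ^ n) (b3 * q ^ n)).

Let row2 (n : nat) : C :=
  coef n * shift_sign b n *
  CSeries (saal_term q (/ (y / q ^ n)) (b1 * q ^ n * (y / q ^ n)) (b2 * q ^ n * (y / q ^ n))
             (b3 * q ^ n * (y / q ^ n))).

Let weight (n : nat) : C :=
  coef n * (qpoch b1 q n * qpoch b2 q n * qpoch b3 q n) * (b * y) ^ n *
  (qpoch_inf (b1 * b2 * y * q ^ n) q * qpoch_inf (b1 * b3 * y * q ^ n) q *
   qpoch_inf (b2 * b3 * y * q ^ n) q).

Let y_pow_neq_0 (n : nat) : y / q ^ n <> 0.
Proof.
pose proof (Cpow_nz q n hq0); apply Cmult_neq_0; [exact hy | now apply Cinv_neq_0].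
Qed.

(** At s = b q^m the product [shifted_prod] vanishes for m < n, so the row starts at m = n.
    Reindexed, its parameters become y q^(-n) and b_i q^n. In [row2] the products b_i q^n y q^(-n) =
    b_i y are unshifted, so both rows belong to the same [saal_diff]. *)
Let row1_has_sum (n : nat) : has_sum (pair1 n) (row1 n).
Proof.
apply (has_sum_shift _ n).
- intros k hk; unfold pair1, term, six_term; rewrite shifted_prod_root by exact hk; ring.
- eapply has_sum_ext; [|apply has_sum_scal, saal_has_sum; assumption].
  intros m; unfold pair1, term, six_term, saal_term; fold coef.
  pose proof (shifted_prod_qpoch_inf b (q ^ (n + m)) n) as E.
  pose proof (Cpow_nz q n hq0) as hn.
  rewrite !qpoch_add.
  replace (qpoch_inf (q * q ^ (n + m)) q) with (qpoch_inf (q ^ (n + m) * q) q)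
    by (f_equal; ring).
  replace (qpoch_inf (q * q ^ m) q) with (qpoch_inf (q ^ (n + m) * q / q ^ n) q)
    by (f_equal; rewrite Cpow_add_r; field; exact hn).
  replace (q / y * q ^ (n + m)) with (q / (y / q ^ n) * q ^ m)
    by (rewrite Cpow_add_r; field; auto).
  replace (c * d * (b * q ^ (n + m)) * q ^ n)
    with (b1 * q ^ n * (b2 * q ^ n) * (b3 * q ^ n) * (y / q ^ n) * q ^ m).
  + match goal with |- ?l = _ * ?B * _ * _ * (_ * ?s * ?Q) =>
      transitivity ((s * qpoch_inf (q ^ (n + m) * q) q) * B * Q * coef n *
        (qpoch b1 q n * qpoch (b1 * q ^ n) q m * (qpoch b2 q n * qpoch (b2 * q ^ n) q m) *
         (qpoch b3 q n * qpoch (b3 * q ^ n) q m)) * q ^ (n + m)) end.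
    * rewrite E, (Cpow_add_r q n m); ring.
    * ring.
  + transitivity (b1 * b2 * b3 * y * q ^ n * q ^ n * q ^ m); [field; exact hn|].
    rewrite <- hbal, Cpow_add_r; ring.
Qed.

Let row2_has_sum (n : nat) : has_sum (pair2 n) (row2 n).
Proof.
eapply has_sum_ext; [|apply has_sum_scal, saal_has_sum; assumption].
intros m; unfold pair2, term, six_term, saal_term; fold coef.
pose proof (shifted_prod_qpoch_inf b (y * q ^ m) n) as E.
pose proof (Cpow_nz q n hq0) as hn.
replace (b * (y * q ^ m)) with (b * y * q ^ m) in E by ring.
replace (q / / y * q ^ m) with (y * q ^ m * q) by (field; exact hy).
replace (q / / (y / q ^ n) * q ^ m) with (y * q ^ m * q / q ^ n) by (field; auto).
replace (b1 * q ^ n * (y / q ^ n)) with (b1 * y) by (field; exact hn).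
replace (b2 * q ^ n * (y / q ^ n)) with (b2 * y) by (field; exact hn).
replace (b3 * q ^ n * (y / q ^ n)) with (b3 * y) by (field; exact hn).
replace (c * d * (b * y * q ^ m) * q ^ n)
  with (b1 * y * (b2 * y) * (b3 * y) * / (y / q ^ n) * q ^ m).
- match goal with |- _ = _ * ?B * _ * _ * (_ * ?s * ?Q) =>
    transitivity ((s * B) * qpoch_inf (q * q ^ m) q * Q * coef n *
      (qpoch (b1 * y) q m * qpoch (b2 * y) q m * qpoch (b3 * y) q m) * q ^ m) end.
  + rewrite E; ring.
  + ring.
- transitivity (b1 * b2 * b3 * y * y * q ^ n * q ^ m); [field; auto|].
  rewrite <- hbal; ring.
Qed.

Let rows_diff (n : nat) :
  qpoch_inf (b1 * y) q * qpoch_inf (b2 * y) q * qpoch_inf (b3 * y) q * row1 n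
  - y * (qpoch_inf b1 q * qpoch_inf b2 q * qpoch_inf b3 q) * row2 n
  = qpoch_inf q q * qpoch_inf y q * qpoch_inf (q / y) q * weight n.
Proof.
pose proof (Cpow_nz q n hq0) as hn.
pose proof (saal_diff_eval q hq (y / q ^ n) (b1 * q ^ n) (b2 * q ^ n) (b3 * q ^ n)
  (y_pow_neq_0 n)) as H.
pose proof (shift_sign_theta b y n hy) as T.
unfold saal_diff, saal_half in H; unfold row1, row2, weight.
rewrite (qpoch_inf_split q hq b1 n), (qpoch_inf_split q hq b2 n), (qpoch_inf_split q hq b3 n).
assert (E1 : forall x, x * q ^ n * (y / q ^ n) * / (y / q ^ n) = x * q ^ n)
  by (intros; field; auto).
rewrite !E1 in H.
replace (b1 * q ^ n * (b2 * q ^ n) * (y / q ^ n)) with (b1 * b2 * y * q ^ n) in H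
  by (field; exact hn).
replace (b1 * q ^ n * (b3 * q ^ n) * (y / q ^ n)) with (b1 * b3 * y * q ^ n) in H
  by (field; exact hn).
replace (b2 * q ^ n * (b3 * q ^ n) * (y / q ^ n)) with (b2 * b3 * y * q ^ n) in H
  by (field; exact hn).
set (S1 := CSeries (saal_term q (y / q ^ n) _ _ _)) in *.
set (S2 := CSeries (saal_term q (/ (y / q ^ n)) _ _ _)) in *.
assert (E2 : forall x, x * q ^ n * (y / q ^ n) = x * y) by (intros; field; exact hn).
rewrite !E2 in H.
set (kappa := coef n * (qpoch b1 q n * qpoch b2 q n * qpoch b3 q n)).
match type of H with ?l = ?r =>
  transitivity (kappa * shift_sign b n * q ^ n * l);
  [unfold kappa; field; exact hn | rewrite H] end.
transitivity (kappa * qpoch_inf q q *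
  (qpoch_inf (b1 * b2 * y * q ^ n) q * qpoch_inf (b1 * b3 * y * q ^ n) q *
   qpoch_inf (b2 * b3 * y * q ^ n) q) *
  (shift_sign b n * q ^ n * (qpoch_inf (y / q ^ n) q * qpoch_inf (q / (y / q ^ n)) q)));
  [ring | rewrite T; unfold kappa; ring].
Qed.

Let rad := ((1 + Cmod (b * y)) / 2)%R.

Let rad_range : (0 < rad < 1)%R.
Proof. unfold rad; pose proof (Cmod_ge_0 (b * y)); lra. Qed.

Let admissible1 (m : nat) : admissible q b rad (b * q ^ m).
Proof. right; now exists m. Qed.

Let admissible2 (m : nat) : admissible q b rad (b * y * q ^ m).
Proof.
left; rewrite Cmod_mult; pose proof (Cmod_q_pow_le q hq m).
pose proof (Cmod_ge_0 (b * y)); pose proof (Cmod_ge_0 (q ^ m)); unfold rad; nra.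
Qed.

Let bound_term : exists K, forall s n m, admissible q b rad (s * q ^ m) ->
  (Cmod (term (s * q ^ m) n) <= K * qbound q (c * d * s) * rad ^ n)%R.
Proof.
destruct (six_term_dominated q hq b c d hbc hbd rad rad_range) as [K HK]; exists K.
intros s n m hs; apply (HK _ (qbound q (c * d * s)) hs).
replace (c * d * (s * q ^ m)) with (c * d * s * q ^ m) by ring.
now apply qbound_mult_pow.
Qed.

(** The columns are summed by [six_at_b_pow]; their terms vanish for n > m, so the 6phi5 is finite
    whatever the size of b. *)
Let row1_sum : has_sum row1
  (/ (qpoch_inf (b * c) q * qpoch_inf (b * d) q) * qpoch_inf (b * c * d) q *
   CSeries (watson_term y b1 b2 b3 b c d)).
Proof.
pose proof (qpoch_inf_neq_0 q hq _ hbc) as h1; pose proof (qpoch_inf_neq_0 q hq _ hbd) as h2.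
destruct bound_term as [K HK].
set (X := (qbound q q * qbound q (q / y) * (qbound q b1 * qbound q b2 * qbound q b3))%R).
refine (has_sum_exchange (X * (K * qbound q (c * d * b))) rad (Cmod q) pair1 row1
  (fun m => qpoch_inf (q * q ^ m) q * qpoch_inf (q / y * q ^ m) q *
     (qpoch b1 q m * qpoch b2 q m * qpoch b3 q m) * q ^ m * CSeries (term (b * q ^ m))) _
  _ (Cmod_q_range q hq) _ row1_has_sum _ _).
- pose proof rad_range; lra.
- intros n m; unfold pair1; rewrite <- Cmod_pow.
  assert (E : (Cmod (qpoch_inf (q * q ^ m) q * qpoch_inf (q / y * q ^ m) q *
     (qpoch b1 q m * qpoch b2 q m * qpoch b3 q m) * q ^ m * term (b * q ^ m) n)
     <= X * Cmod (q ^ m) * (K * qbound q (c * d * b) * rad ^ n))%R).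
  { unfold X; apply Cmod_mult_le; [|apply HK, admissible1].
    repeat apply Cmod_mult_le; try (now apply Cmod_qpoch_inf_pow_le);
      try (now apply Cmod_qpoch_le); apply Rle_refl. }
  eapply Rle_trans; [exact E|].
  right; ring.
- intros m; unfold pair1; apply has_sum_scal.
  exact (six_has_sum q hq b c d hbc hbd rad _ rad_range (admissible1 m)).
- eapply has_sum_ext; [|apply has_sum_scal, watson_has_sum].
  intros m; pose proof (six_at_b_pow q hq b c d hbc hbd m) as E; fold term in E.
  unfold watson_term.
  replace (CSeries (term (b * q ^ m)))
    with (/ (qpoch_inf (b * c) q * qpoch_inf (b * d) q) *
          (qpoch_inf (b * c) q * qpoch_inf (b * d) q * CSeries (term (b * q ^ m))))
    by (field; auto).
  rewrite E; ring.
Qed.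

Let row2_sum : has_sum row2
  (/ (qpoch_inf (b * c) q * qpoch_inf (b * d) q * qpoch_inf (b * y) q) *
   (qpoch_inf b q * qpoch_inf (b * c * d) q) *
   CSeries (watson_term (/ y) (b1 * y) (b2 * y) (b3 * y) (b * y) c d)).
Proof.
pose proof (qpoch_inf_neq_0 q hq _ hbc) as h1; pose proof (qpoch_inf_neq_0 q hq _ hbd) as h2.
pose proof (qpoch_inf_neq_0_of_lt_1 q hq _ hz) as h3.
destruct bound_term as [K HK].
set (X := (qbound q q * qbound q (q / / y) *
           (qbound q (b1 * y) * qbound q (b2 * y) * qbound q (b3 * y)))%R).
refine (has_sum_exchange (X * (K * qbound q (c * d * (b * y)))) rad (Cmod q) pair2 row2
  (fun m => qpoch_inf (q * q ^ m) q * qpoch_inf (q / / y * q ^ m) q *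
     (qpoch (b1 * y) q m * qpoch (b2 * y) q m * qpoch (b3 * y) q m) * q ^ m *
     CSeries (term (b * y * q ^ m))) _
  _ (Cmod_q_range q hq) _ row2_has_sum _ _).
- pose proof rad_range; lra.
- intros n m; unfold pair2; rewrite <- Cmod_pow.
  assert (E : (Cmod (qpoch_inf (q * q ^ m) q * qpoch_inf (q / / y * q ^ m) q *
     (qpoch (b1 * y) q m * qpoch (b2 * y) q m * qpoch (b3 * y) q m) * q ^ m *
     term (b * y * q ^ m) n)
     <= X * Cmod (q ^ m) * (K * qbound q (c * d * (b * y)) * rad ^ n))%R).
  { unfold X; apply Cmod_mult_le; [|apply HK, admissible2].
    repeat apply Cmod_mult_le; try (now apply Cmod_qpoch_inf_pow_le);
      try (now apply Cmod_qpoch_le); apply Rle_refl. }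
  eapply Rle_trans; [exact E|].
  right; ring.
- intros m; unfold pair2; apply has_sum_scal.
  exact (six_has_sum q hq b c d hbc hbd rad _ rad_range (admissible2 m)).
- eapply has_sum_ext; [|apply has_sum_scal, watson_has_sum].
  intros m; assert (hs : (Cmod (b * y * q ^ m) < 1)%R).
  { rewrite Cmod_mult; pose proof (Cmod_q_pow_le q hq m).
    pose proof (Cmod_ge_0 (b * y)); pose proof (Cmod_ge_0 (q ^ m)); nra. }
  pose proof (six_eval q hq b c d hbc hbd _ hs) as E; fold term in E.
  unfold watson_term.
  pose proof (qpoch_inf_neq_0_of_lt_1 q hq _ hs) as h4.
  replace (CSeries (term (b * y * q ^ m)))
    with (/ (qpoch_inf (b * c) q * qpoch_inf (b * d) q * qpoch_inf (b * y * q ^ m) q) *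
          (qpoch_inf (b * c) q * qpoch_inf (b * d) q *
           (qpoch_inf (b * y * q ^ m) q * CSeries (term (b * y * q ^ m)))))
    by (field; auto).
  rewrite E.
  (* Splitting (by; q)_oo turns 1/(by q^m; q)_oo from [six_eval] into (by; q)_m / (by; q)_oo, which
     supplies the fourth numerator factorial of [watson_term]. *)
  pose proof (qpoch_neq_0_of_inf q hq (b * y) m h3) as h5.
  rewrite (qpoch_inf_split q hq (b * y) m) in h3 |- *.
  replace (c * (b * y * q ^ m)) with (b * y * c * q ^ m) by ring.
  replace (d * (b * y * q ^ m)) with (b * y * d * q ^ m) by ring.
  field; auto.
Qed.

(** Both sides are the sum of [rows_diff] over n: the left through the column sums, the right
    through [weight], whose tails (b_i b_j y q^n; q)_oo are the denominators (b_i b_j y; q)_n of the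
    8W7 in disguise. *)
Lemma watson_diff :
  (forall n, qpoch (b1 * b2 * y) q n <> 0) -> (forall n, qpoch (b1 * b3 * y) q n <> 0) ->
  (forall n, qpoch (b2 * b3 * y) q n <> 0) ->
  qpoch_inf (b * c * d) q *
  (watson_half y b1 b2 b3 b c d
   - y * watson_half (/ y) (b1 * y) (b2 * y) (b3 * y) (b * y) c d)
  = qpoch_inf q q * qpoch_inf y q * qpoch_inf (q / y) q * qpoch_inf (b * y) q *
    (qpoch_inf (b2 * b3 * y) q * qpoch_inf (b1 * b3 * y) q * qpoch_inf (b1 * b2 * y) q *
     qpoch_inf (b * d) q * qpoch_inf (b * c) q) *
    CSeries (vwp_series_term (b * c * d) b1 b2 b3 c d
      (b2 * b3 * y) (b1 * b3 * y) (b1 * b2 * y) (b * d) (b * c) (b * y)).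
Proof.
intros h12 h13 h23.
pose proof (qpoch_inf_neq_0 q hq _ hbc) as h1; pose proof (qpoch_inf_neq_0 q hq _ hbd) as h2.
pose proof (qpoch_inf_neq_0_of_lt_1 q hq _ hz) as h3.
set (V := vwp_series_term _ _ _ _ _ _ _ _ _ _ _ _).
assert (HV : has_sum V (CSeries V)) by (apply vwp_series_has_sum; auto).
pose proof (has_sum_plus _ _ _ _
  (has_sum_scal (qpoch_inf (b1 * y) q * qpoch_inf (b2 * y) q * qpoch_inf (b3 * y) q) _ _ row1_sum)
  (has_sum_scal (- (y * (qpoch_inf b1 q * qpoch_inf b2 q * qpoch_inf b3 q))) _ _ row2_sum)) as HL.
assert (HR : has_sum (fun n =>
    qpoch_inf (b1 * y) q * qpoch_inf (b2 * y) q * qpoch_inf (b3 * y) q * row1 n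
    + - (y * (qpoch_inf b1 q * qpoch_inf b2 q * qpoch_inf b3 q)) * row2 n)
  (qpoch_inf q q * qpoch_inf y q * qpoch_inf (q / y) q *
   (qpoch_inf (b2 * b3 * y) q * qpoch_inf (b1 * b3 * y) q * qpoch_inf (b1 * b2 * y) q) *
   CSeries V)).
{ eapply has_sum_ext; [|apply has_sum_scal, HV].
  intros n; match goal with |- _ = ?p * ?r + - ?s * ?t =>
    transitivity (p * r - s * t); [|ring] end.
  rewrite rows_diff; unfold V, vwp_series_term, weight, coef, six_coef.
  rewrite (qpoch_inf_split q hq (b2 * b3 * y) n), (qpoch_inf_split q hq (b1 * b3 * y) n),
    (qpoch_inf_split q hq (b1 * b2 * y) n).
  pose proof (qpoch_q_neq_0 q hq n); pose proof (hbc n); pose proof (hbd n).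
  pose proof (h12 n); pose proof (h13 n); pose proof (h23 n).
  field; repeat split; assumption. }
pose proof (has_sum_unique _ _ _ HL HR) as E.
unfold watson_half.
replace (b1 * y * / y) with b1 by (field; exact hy).
replace (b2 * y * / y) with b2 by (field; exact hy).
replace (b3 * y * / y) with b3 by (field; exact hy).
replace (b * y * / y) with b by (field; exact hy).
match type of E with ?l = ?r =>
  transitivity (qpoch_inf (b * c) q * qpoch_inf (b * d) q * qpoch_inf (b * y) q * l);
  [field; auto | rewrite E; ring] end.
Qed.

End Expansion.

End NonterminatingWatson.

(** * Differences of point sums *)

Section ThreeTerm.

Variable q : C.
Hypothesis hq0 : q <> 0.
Hypothesis hq : (Cmod q < 1)%R.

Definition point_prod (r1 r2 r3 r4 p : C) : C :=
  qpoch_inf (p * r1) q * qpoch_inf (p * r2) q * qpoch_inf (p * r3) q * qpoch_inf (p * r4) q.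

(** q^m F(p q^m) cleared by [point_prod] at p: each quotient (rp; q)_oo / (rp q^m; q)_oo has become
    (rp; q)_m. *)
Definition point_term (p1 p2 p3 p4 r1 r2 r3 r4 p : C) (m : nat) : C :=
  qpoch_inf (q * p / p1 * q ^ m) q * qpoch_inf (q * p / p2 * q ^ m) q *
  qpoch_inf (q * p / p3 * q ^ m) q * qpoch_inf (q * p / p4 * q ^ m) q *
  (qpoch (p * r1) q m * qpoch (p * r2) q m * qpoch (p * r3) q m * qpoch (p * r4) q m) *
  q ^ m.

(** [watson_diff] with y = p1/p2, b_i = p2 r_i, b = p2 r4, c = q/(p3 r4), d = q/(p4 r4); the
    balancing condition becomes the product q^2. The 8W7 parameters are variables with equations, so
    that an application can prescribe their form and leave the equations to [field]. *)
Lemma watson_points (p1 p2 p3 p4 r1 r2 r3 r4 A b1 b2 b3 b4 b5 c1 c2 c3 c4 c5 z : C) :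
  p1 <> 0 -> p2 <> 0 -> p3 <> 0 -> p4 <> 0 -> r4 <> 0 ->
  p1 * p2 * p3 * p4 * (r1 * r2 * r3 * r4) = q * q ->
  A = p1 * p2 * p2 * (r1 * r2 * r3) ->
  b1 = p2 * r1 -> b2 = p2 * r2 -> b3 = p2 * r3 -> b4 = q / (p3 * r4) -> b5 = q / (p4 * r4) ->
  c1 = p1 * p2 * r2 * r3 -> c2 = p1 * p2 * r1 * r3 -> c3 = p1 * p2 * r1 * r2 ->
  c4 = q * p2 / p4 -> c5 = q * p2 / p3 -> z = p1 * r4 ->
  (Cmod z < 1)%R ->
  (forall n, qpoch c1 q n <> 0) -> (forall n, qpoch c2 q n <> 0) ->
  (forall n, qpoch c3 q n <> 0) -> (forall n, qpoch c4 q n <> 0) ->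
  (forall n, qpoch c5 q n <> 0) ->
  qpoch_inf A q *
  (point_prod r1 r2 r3 r4 p1 * CSeries (point_term p1 p2 p3 p4 r1 r2 r3 r4 p2)
   - p1 / p2 *
     (point_prod r1 r2 r3 r4 p2 * CSeries (point_term p1 p2 p3 p4 r1 r2 r3 r4 p1)))
  = qpoch_inf q q * qpoch_inf (p1 / p2) q * qpoch_inf (q * p2 / p1) q * qpoch_inf z q *
    (qpoch_inf c1 q * qpoch_inf c2 q * qpoch_inf c3 q * qpoch_inf c4 q * qpoch_inf c5 q) *
    CSeries (vwp_series_term q A b1 b2 b3 b4 b5 c1 c2 c3 c4 c5 z).
Proof.
intros h1 h2 h3 h4 hr hbal eA eb1 eb2 eb3 eb4 eb5 e1 e2 e3 e4 e5 ez hz n1 n2 n3 n4 n5.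
assert (f1 : b2 * b3 * (p1 / p2) = c1) by (subst; field; auto).
assert (f2 : b1 * b3 * (p1 / p2) = c2) by (subst; field; auto).
assert (f3 : b1 * b2 * (p1 / p2) = c3) by (subst; field; auto).
assert (f4 : p2 * r4 * b5 = c4) by (subst; field; auto).
assert (f5 : p2 * r4 * b4 = c5) by (subst; field; auto).
assert (fz : p2 * r4 * (p1 / p2) = z) by (subst; field; auto).
assert (fA' : p2 * r4 * b4 * b5 = b1 * b2 * b3 * (p1 / p2)).
{ subst; transitivity (q * q * p2 / (p3 * p4 * r4)); [field; auto|].
  rewrite <- hbal; field; auto. }
assert (fA : p2 * r4 * b4 * b5 = A) by (rewrite fA'; subst; field; auto).
assert (hy : p1 / p2 <> 0) by (apply Cmult_neq_0; [exact h1 | now apply Cinv_neq_0]).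
pose proof (watson_diff q hq0 hq (p1 / p2) b1 b2 b3 (p2 * r4) b4 b5 hy fA') as W.
rewrite fA, f1, f2, f3, f4, f5, fz in W.
specialize (W hz n5 n4 n3 n2 n1).
replace (q / (p1 / p2)) with (q * p2 / p1) in W by (field; auto).
assert (g : forall r, p2 * r * (p1 / p2) = p1 * r) by (intros; field; auto).
assert (g' : forall r, p1 * r * / (p1 / p2) = p2 * r) by (intros; field; auto).
assert (E2 : CSeries (watson_term q (p1 / p2) b1 b2 b3 (p2 * r4) b4 b5)
             = CSeries (point_term p1 p2 p3 p4 r1 r2 r3 r4 p2)).
{ apply CSeries_ext; intros m; unfold point_term, watson_term.
  rewrite f4, f5, e4, e5, eb1, eb2, eb3.
  replace (q * p2 / p2) with q by (field; auto).
  replace (q / (p1 / p2)) with (q * p2 / p1) by (field; auto).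
  ring. }
assert (E1 : CSeries (watson_term q (/ (p1 / p2)) (p1 * r1) (p1 * r2) (p1 * r3) (p1 * r4) b4 b5)
             = CSeries (point_term p1 p2 p3 p4 r1 r2 r3 r4 p1)).
{ apply CSeries_ext; intros m; unfold point_term, watson_term.
  replace (q * p1 / p1) with q by (field; auto).
  replace (q / / (p1 / p2)) with (q * p1 / p2) by (field; auto).
  replace (p1 * r4 * b4) with (q * p1 / p3) by (rewrite eb4; field; auto).
  replace (p1 * r4 * b5) with (q * p1 / p4) by (rewrite eb5; field; auto).
  ring. }
rewrite <- W, <- E1, <- E2, ez; unfold watson_half, point_prod.
replace (b1 * (p1 / p2)) with (p1 * r1) by (rewrite eb1; now rewrite g).
replace (b2 * (p1 / p2)) with (p1 * r2) by (rewrite eb2; now rewrite g).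
replace (b3 * (p1 / p2)) with (p1 * r3) by (rewrite eb3; now rewrite g).
rewrite !g', g; ring.
Qed.

Lemma vwp_qpoch (alpha : C) (n : nat) :
  (1 - alpha) * vwp q (alpha * q) n = qpoch alpha q n * (1 - alpha * q ^ (2 * n)).
Proof.
destruct n as [|n].
- simpl; ring.
- rewrite qpoch_S_l; unfold vwp.
  replace (2 * S n)%nat with (S (2 * n + 1)) by lia; simpl Cpow; ring.
Qed.

End ThreeTerm.

(** * The three series of the theorem *)

Section Terms.

Variables q A B a b x y : C.
Hypothesis hq0 : q <> 0.
Hypothesis hq : (Cmod q < 1)%R.
Hypotheses (hA : A <> 0) (hB : B <> 0) (ha : a <> 0) (hb : b <> 0) (hx : x <> 0) (hy : y <> 0).

(** The 8W7 with alpha = x; the first slot holds alpha q. In [vwp2] alpha is xya^2/(Bq), in [vwp3]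
    it is xa^2/(yA). *)
Definition vwp1 : nat -> C :=
  vwp_series_term q (x * q) y (- (x * a / B)) (A * B / (a * b)) (- (q / a)) (- (x * a / A))
    (x * q / y) (- (B * q / a)) (x * a * b * q / (A * B)) (- (x * a)) (- (A * q / a))
    (- (b * q / y)).

Definition vwp2 : nat -> C :=
  vwp_series_term q (x * y * a ^ 2 / B) y (- (x * a / B)) A (- (y * a / B))
    (- (x * a ^ 2 * b / (A * B)))
    (x * a ^ 2 / B) (- (y * a)) (x * y * a ^ 2 / (A * B)) (- (x * a)) (- (y * A / b))
    (- (B / b)).

Definition vwp3 : nat -> C :=
  vwp_series_term q (x * a ^ 2 * q / (y * A)) (x * a ^ 2 / (A * B)) (- a) (- (B / b)) (q / y)
    (- (x * a / y))
    (B * q / y) (- (x * a * q / (y * A))) (- (x * a ^ 2 * b * q / (y * A * B)))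
    (x * a ^ 2 / A) (- (a * q / A)) (- (b * q / A)).

(** By (u; q)_{k+1} = (1 - u)(uq; q)_k the denominator splits into factors free of k and the
    factorials of the 8W7; every factor of a nonzero product is nonzero. *)
Lemma sum1_den_factors : (forall k, sum1_den q A B a b x y k <> 0) ->
  (1 + A / a <> 0 /\ 1 + B / a <> 0 /\ 1 - x * a * b / (A * B) <> 0) /\
  (forall n, qpoch (x * q / y) q n <> 0) /\ (forall n, qpoch (- (B * q / a)) q n <> 0) /\
  (forall n, qpoch (x * a * b * q / (A * B)) q n <> 0) /\
  (forall n, qpoch (- (x * a)) q n <> 0) /\ (forall n, qpoch (- (A * q / a)) q n <> 0).
Proof.
intros H.
assert (E : forall k, sum1_den q A B a b x y k =
  (1 + A / a) * (1 + B / a) * (1 - x * a * b / (A * B)) *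
  (qpoch (x * q / y) q k * qpoch (- (B * q / a)) q k * qpoch (x * a * b * q / (A * B)) q k *
   qpoch (- (x * a)) q k * qpoch (- (A * q / a)) q k) * qpoch q q k).
{ intros k; unfold sum1_den, qpochs, fold_right; rewrite !qpoch_S_l.
  replace (- (A / a) * q) with (- (A * q / a)) by (field; auto).
  replace (- (B / a) * q) with (- (B * q / a)) by (field; auto).
  replace (x * a * b / (A * B) * q) with (x * a * b * q / (A * B)) by (field; auto).
  ring. }
repeat split;
  lazymatch goal with
  | |- forall _ : nat, _ => intros n Z; apply (H n)
  | _ => intros Z; apply (H O)
  end; rewrite E, Z; ring.
Qed.

Lemma sum2_den_factors : (forall k, sum2_den q A B a b x y k <> 0) ->
  (1 + y * a / q <> 0 /\ 1 + y * A / (b * q) <> 0 /\ 1 - x * y * a ^ 2 / (A * B * q) <> 0) /\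
  (forall n, qpoch (x * a ^ 2 / B) q n <> 0) /\ (forall n, qpoch (- (y * a)) q n <> 0) /\
  (forall n, qpoch (x * y * a ^ 2 / (A * B)) q n <> 0) /\
  (forall n, qpoch (- (x * a)) q n <> 0) /\ (forall n, qpoch (- (y * A / b)) q n <> 0).
Proof.
intros H.
assert (E : forall k, sum2_den q A B a b x y k =
  (1 + y * a / q) * (1 + y * A / (b * q)) * (1 - x * y * a ^ 2 / (A * B * q)) *
  (qpoch (x * a ^ 2 / B) q k * qpoch (- (y * a)) q k * qpoch (x * y * a ^ 2 / (A * B)) q k *
   qpoch (- (x * a)) q k * qpoch (- (y * A / b)) q k) * qpoch q q k).
{ intros k; unfold sum2_den, qpochs, fold_right; rewrite !qpoch_S_l.
  replace (- (y * a / q) * q) with (- (y * a)) by (field; auto).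
  replace (- (y * A / (b * q)) * q) with (- (y * A / b)) by (field; auto).
  replace (x * y * a ^ 2 / (A * B * q) * q) with (x * y * a ^ 2 / (A * B)) by (field; auto).
  ring. }
repeat split;
  lazymatch goal with
  | |- forall _ : nat, _ => intros n Z; apply (H n)
  | _ => intros Z; apply (H O)
  end; rewrite E, Z; ring.
Qed.

Let W_den (k : nat) : C :=
  W87_den (x * a ^ 2 / (y * A)) (q / y) (- (x * a / y))
    (x * a ^ 2 / (A * B)) (- a) (- (B / b)) q k.

Lemma W_den_factors : (forall k, W_den k <> 0) ->
  1 - x * a ^ 2 / (y * A) <> 0 /\
  (forall n, qpoch (B * q / y) q n <> 0) /\ (forall n, qpoch (- (x * a * q / (y * A))) q n <> 0) /\
  (forall n, qpoch (- (x * a ^ 2 * b * q / (y * A * B))) q n <> 0) /\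
  (forall n, qpoch (x * a ^ 2 / A) q n <> 0) /\ (forall n, qpoch (- (a * q / A)) q n <> 0).
Proof.
intros H.
assert (E : forall k, W_den k = (1 - x * a ^ 2 / (y * A)) *
  (qpoch (B * q / y) q k * qpoch (- (x * a * q / (y * A))) q k *
   qpoch (- (x * a ^ 2 * b * q / (y * A * B))) q k *
   qpoch (x * a ^ 2 / A) q k * qpoch (- (a * q / A)) q k) * qpoch q q k).
{ intros k; unfold W_den, W87_den, qpochs, fold_right.
  replace (x * a ^ 2 / (y * A) * q / (q / y)) with (x * a ^ 2 / A) by (field; auto).
  replace (x * a ^ 2 / (y * A) * q / - (x * a / y)) with (- (a * q / A)) by (field; auto).
  replace (x * a ^ 2 / (y * A) * q / (x * a ^ 2 / (A * B))) with (B * q / y) by (field; auto).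
  replace (x * a ^ 2 / (y * A) * q / - a) with (- (x * a * q / (y * A))) by (field; auto).
  replace (x * a ^ 2 / (y * A) * q / - (B / b)) with (- (x * a ^ 2 * b * q / (y * A * B)))
    by (field; auto).
  ring. }
repeat split;
  lazymatch goal with
  | |- forall _ : nat, _ => intros n Z; apply (H n)
  | _ => intros Z; apply (H O)
  end; rewrite E, Z; ring.
Qed.

Lemma sum1_term_vwp : (forall k, sum1_den q A B a b x y k <> 0) -> forall k,
  sum1_term q A B a b x y k
  = (1 - x) / ((1 + A / a) * (1 + B / a) * (1 - x * a * b / (A * B))) * vwp1 k.
Proof.
intros H k; destruct (sum1_den_factors H) as [[n1 [n2 n3]] [m1 [m2 [m3 [m4 m5]]]]].
pose proof (qpoch_q_neq_0 q hq k); specialize (m1 k); specialize (m2 k);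
  specialize (m3 k); specialize (m4 k); specialize (m5 k).
unfold sum1_term, sum1_den, vwp1, vwp_series_term, qpochs, fold_right; rewrite !qpoch_S_l.
replace (- (A / a) * q) with (- (A * q / a)) by (field; auto).
replace (- (B / a) * q) with (- (B * q / a)) by (field; auto).
replace (x * a * b / (A * B) * q) with (x * a * b * q / (A * B)) by (field; auto).
replace (- (b * q / y)) with (- b * (q / y)) by (field; auto).
rewrite Cpow_mult_l.
pose proof (vwp_qpoch q x k) as V.
replace (1 - q ^ (2 * k) * x) with (1 - x * q ^ (2 * k)) by ring.
replace (1 - - (A / a)) with (1 + A / a) by ring.
replace (1 - - (B / a)) with (1 + B / a) by ring.
set (n1' := 1 + A / a) in *; set (n2' := 1 + B / a) in *; set (n3' := 1 - x * a * b / (A * B)) in *.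
set (W := 1 - x * q ^ (2 * k)) in *.
(* Brings (x; q)_k and 1 - x q^(2k) together, so that [vwp_qpoch] replaces them by (1 - x) times
   [vwp], without dividing by 1 - x. *)
match goal with |- ?l = _ => match l with context [?p * (?p2 * (?p3 * (?p4 * RtoC 1))) * W] =>
  replace (p * (p2 * (p3 * (p4 * RtoC 1))) * W) with ((p * W) * (p2 * p3 * p4)) by ring end end.
rewrite <- V.
field; repeat split; assumption.
Qed.

Lemma sum2_term_vwp : (forall k, sum2_den q A B a b x y k <> 0) -> forall k,
  sum2_term q A B a b x y k
  = (1 - x * y * a ^ 2 / (B * q)) /
    ((1 + y * a / q) * (1 + y * A / (b * q)) * (1 - x * y * a ^ 2 / (A * B * q))) * vwp2 k.
Proof.
intros H k; destruct (sum2_den_factors H) as [[n1 [n2 n3]] [m1 [m2 [m3 [m4 m5]]]]].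
pose proof (qpoch_q_neq_0 q hq k); specialize (m1 k); specialize (m2 k);
  specialize (m3 k); specialize (m4 k); specialize (m5 k).
unfold sum2_term, sum2_den, vwp2, vwp_series_term, qpochs, fold_right; rewrite !qpoch_S_l.
replace (- (y * a / q) * q) with (- (y * a)) by (field; auto).
replace (- (y * A / (b * q)) * q) with (- (y * A / b)) by (field; auto).
replace (x * y * a ^ 2 / (A * B * q) * q) with (x * y * a ^ 2 / (A * B)) by (field; auto).
pose proof (vwp_qpoch q (x * y * a ^ 2 / (B * q)) k) as V.
replace (x * y * a ^ 2 / (B * q) * q) with (x * y * a ^ 2 / B) in V by (field; auto).
replace (1 - q ^ (2 * k) / q * (x * y * a ^ 2 / B))
  with (1 - x * y * a ^ 2 / (B * q) * q ^ (2 * k)) by (field; auto).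
replace (1 - - (y * a / q)) with (1 + y * a / q) by ring.
replace (1 - - (y * A / (b * q))) with (1 + y * A / (b * q)) by ring.
set (n1' := 1 + y * a / q) in *; set (n2' := 1 + y * A / (b * q)) in *;
  set (n3' := 1 - x * y * a ^ 2 / (A * B * q)) in *.
set (W := 1 - x * y * a ^ 2 / (B * q) * q ^ (2 * k)) in *.
match goal with |- ?l = _ => match l with context [?u * (?p * (?p2 * (?p3 * (?p4 * RtoC 1)))) * W] =>
  replace (u * (p * (p2 * (p3 * (p4 * RtoC 1)))) * W) with ((p * W) * (u * p2 * p3 * p4)) by ring end end.
rewrite <- V.
set (n4' := 1 - x * y * a ^ 2 / (B * q)) in *.
field; repeat split; assumption.
Qed.

Lemma W_term_vwp : (forall k, W_den k <> 0) -> forall k,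
  W87_term (x * a ^ 2 / (y * A)) (q / y) (- (x * a / y))
    (x * a ^ 2 / (A * B)) (- a) (- (B / b)) q (- (b * q / A)) k = vwp3 k.
Proof.
intros H k; destruct (W_den_factors H) as [n1 [m1 [m2 [m3 [m4 m5]]]]].
pose proof (qpoch_q_neq_0 q hq k); specialize (m1 k); specialize (m2 k);
  specialize (m3 k); specialize (m4 k); specialize (m5 k).
unfold W87_term, W87_den, vwp3, vwp_series_term, qpochs, fold_right.
replace (x * a ^ 2 / (y * A) * q / (q / y)) with (x * a ^ 2 / A) by (field; auto).
replace (x * a ^ 2 / (y * A) * q / - (x * a / y)) with (- (a * q / A)) by (field; auto).
replace (x * a ^ 2 / (y * A) * q / (x * a ^ 2 / (A * B))) with (B * q / y) by (field; auto).
replace (x * a ^ 2 / (y * A) * q / - a) with (- (x * a * q / (y * A))) by (field; auto).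
replace (x * a ^ 2 / (y * A) * q / - (B / b)) with (- (x * a ^ 2 * b * q / (y * A * B)))
  by (field; auto).
pose proof (vwp_qpoch q (x * a ^ 2 / (y * A)) k) as V.
replace (x * a ^ 2 / (y * A) * q) with (x * a ^ 2 * q / (y * A)) in V by (field; auto).
set (W := 1 - x * a ^ 2 / (y * A) * q ^ (2 * k)) in *.
match goal with |- ?l = _ => match l with context [?p * ?r * W] =>
  replace (p * r * W) with ((p * W) * r) by ring end end.
rewrite <- V.
set (n4' := 1 - x * a ^ 2 / (y * A)) in *.
field; repeat split; assumption.
Qed.

End Terms.

(** * Matching the coefficients *)

Lemma has_sum_scal_ext (c : C) (u v : nat -> C) (l : C) :
  (forall k, u k = c * v k) -> has_sum v l -> has_sum u (c * l).
Proof. intros E H; eapply has_sum_ext; [intros k; symmetry; apply E | now apply has_sum_scal]. Qed.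

(* [e3 (e1 s2 - p1 e2 s1) = e1 (e3 s2 - p3 e2 s3) + p3 e2 (e1 s3 - (p1/p3) e3 s1)]. *)
Lemma three_point_elim (p1 p3 d1 d2 d3 e1 e2 e3 s1 s2 s3 k1 k2 k3 v1 v2 v3 : C) :
  p3 <> 0 -> d2 <> 0 -> d3 <> 0 -> e3 <> 0 -> k1 <> 0 ->
  d1 * (e1 * s2 - p1 * (e2 * s1)) = k1 * v1 ->
  d2 * (e3 * s2 - p3 * (e2 * s3)) = k2 * v2 ->
  d3 * (e1 * s3 - p1 / p3 * (e3 * s1)) = k3 * v3 ->
  v1 = d1 / (k1 * e3) * (e1 * k2 / d2 * v2 + p3 * e2 * k3 / d3 * v3).
Proof.
intros hp hd2 hd3 he3 hk1 H1 H2 H3.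
replace v1 with (/ k1 * (k1 * v1)) by (field; auto).
replace (e1 * k2 / d2 * v2) with (e1 / d2 * (k2 * v2)) by (field; auto).
replace (p3 * e2 * k3 / d3 * v3) with (p3 * e2 / d3 * (k3 * v3)) by (field; auto).
rewrite <- H1, <- H2, <- H3; field; auto.
Qed.

Lemma qpochs_inf_neq_0 (l : list C) (q : C) :
  qpochs_inf l q <> 0 -> forall u, In u l -> qpoch_inf u q <> 0.
Proof.
induction l as [|v l IH]; simpl; [intros _ u []|].
intros H u [->|hu] E.
- apply H; rewrite E; ring.
- apply (IH (fun Z => H (eq_trans (f_equal (Cmult _) Z) (Cmult_0_r _))) u hu E).
Qed.

Ltac canon u v :=
  replace u with v by (field; repeat split; assumption).

Ltac abstract_qpoch_inf q :=
  repeat match goal with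
  | |- context [qpoch_inf ?u q] =>
      let z := fresh "z" in set (z := qpoch_inf u q) in *; clearbody z
  end.

Lemma Cmult_neq_0_inv (x y : C) : x * y <> 0 -> x <> 0 /\ y <> 0.
Proof. intros H; split; intros E; apply H; rewrite E; ring. Qed.

Ltac split_neq_0 :=
  repeat match goal with
  | H : _ * _ <> _ |- _ =>
      let H1 := fresh "H" in let H2 := fresh "H" in
      destruct (Cmult_neq_0_inv _ _ H) as [H1 H2]; clear H
  end.

(** * The three point differences and the comparison of their coefficients *)

Section Relations.

Variables q A B a b x y : C.
Hypothesis hq0 : q <> 0.
Hypothesis hq : (Cmod q < 1)%R.
Hypotheses (hA : A <> 0) (hB : B <> 0) (ha : a <> 0) (hb : b <> 0) (hx : x <> 0) (hy : y <> 0).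

Let p1 : C := - (b * q / (y * A)).
Let p3 : C := - (a / A).
Let p4 : C := - (q / (x * a)).
Let r2 : C := - (x * a / B).
Let r3 : C := A * B / (a * b).

Let sum_at (p : C) : C := CSeries (point_term q p1 1 p3 p4 y r2 r3 A p).

Let hp1 : p1 <> 0.
Proof.
unfold p1; intros E; apply hb.
replace b with (- - (b * q / (y * A)) * (y * A / q)) by (field; auto); rewrite E; ring.
Qed.

Let hp3 : p3 <> 0.
Proof.
unfold p3; intros E; apply ha.
replace a with (- - (a / A) * A) by (field; auto); rewrite E; ring.
Qed.

Let hp4 : p4 <> 0.
Proof.
unfold p4; intros E; apply hq0.
replace q with (- - (q / (x * a)) * (x * a)) by (field; auto); rewrite E; ring.
Qed.

Let hr3 : r3 <> 0.
Proof.
unfold r3; intros E; apply (Cmult_neq_0 _ _ hA hB).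
replace (A * B) with (A * B / (a * b) * (a * b)) by (field; auto); rewrite E; ring.
Qed.

Let e1 : C := qpochs_inf [- (b * q / A); x * a * b * q / (y * A * B);
                          - (B * q / (y * a)); - (b * q / y)] q.
Let e2 : C := qpochs_inf [y; - (x * a / B); A * B / (a * b); A] q.
Let e3 : C := qpochs_inf [- (y * a / A); x * a ^ 2 / (A * B); - (B / b); - a] q.

Let point_prod_p1 : point_prod q y r2 r3 A p1 = e1.
Proof.
unfold point_prod, e1, qpochs_inf, fold_right, p1, r2, r3.
canon (- (b * q / (y * A)) * y) (- (b * q / A)).
canon (- (b * q / (y * A)) * - (x * a / B)) (x * a * b * q / (y * A * B)).
canon (- (b * q / (y * A)) * (A * B / (a * b))) (- (B * q / (y * a))).
canon (- (b * q / (y * A)) * A) (- (b * q / y)).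
ring.
Qed.

Let point_prod_p2 : point_prod q y r2 r3 A 1 = e2.
Proof.
unfold point_prod, e2, qpochs_inf, fold_right, r2, r3; rewrite !Cmult_1_l; ring.
Qed.

Let point_prod_p3 : point_prod q y r2 r3 A p3 = e3.
Proof.
unfold point_prod, e3, qpochs_inf, fold_right, p3, r2, r3.
canon (- (a / A) * y) (- (y * a / A)).
canon (- (a / A) * - (x * a / B)) (x * a ^ 2 / (A * B)).
canon (- (a / A) * (A * B / (a * b))) (- (B / b)).
canon (- (a / A) * A) (- a).
ring.
Qed.

Let relation1 :
  (Cmod (b * q / y) < 1)%R -> (forall k, sum1_den q A B a b x y k <> 0) ->
  qpoch_inf (x * q) q * (e1 * sum_at 1 - p1 * (e2 * sum_at p1))
  = qpochs_inf [q; - (b * q / (y * A)); - (y * A / b); - (b * q / y); x * q / y;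
                - (B * q / a); x * a * b * q / (A * B); - (x * a); - (A * q / a)] q *
    CSeries (vwp1 q A B a b x y).
Proof.
intros hz hd; destruct (sum1_den_factors q A B a b x y) as [_ [m1 [m2 [m3 [m4 m5]]]]]; auto.
rewrite <- Cmod_opp in hz.
rewrite <- point_prod_p1, <- point_prod_p2.
replace (p1 * (point_prod q y r2 r3 A 1 * sum_at p1))
  with (p1 / 1 * (point_prod q y r2 r3 A 1 * sum_at p1)) by (field; exact C1_nz).
unfold vwp1.
etransitivity; [apply (watson_points q hq0 hq p1 1 p3 p4 y r2 r3 A (x * q)
  y (- (x * a / B)) (A * B / (a * b)) (- (q / a)) (- (x * a / A))
  (x * q / y) (- (B * q / a)) (x * a * b * q / (A * B)) (- (x * a)) (- (A * q / a))
  (- (b * q / y))); auto using C1_nz; unfold p1, p3, p4, r2, r3;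
  field; repeat split; auto using C1_nz |].
unfold qpochs_inf, fold_right, p1.
replace (- (b * q / (y * A)) / 1) with (- (b * q / (y * A))) by (field; auto).
replace (q * 1 / - (b * q / (y * A))) with (- (y * A / b)) by (field; auto).
ring.
Qed.

Let relation2 :
  (Cmod (B / b) < 1)%R -> (forall k, sum2_den q A B a b x y k <> 0) ->
  qpoch_inf (x * y * a ^ 2 / B) q * (e3 * sum_at 1 - p3 * (e2 * sum_at p3))
  = qpochs_inf [q; - (a / A); - (A * q / a); - (B / b); x * a ^ 2 / B; - (y * a);
                x * y * a ^ 2 / (A * B); - (x * a); - (y * A / b)] q *
    CSeries (vwp2 q A B a b x y).
Proof.
intros hz hd; destruct (sum2_den_factors q A B a b x y) as [_ [m1 [m2 [m3 [m4 m5]]]]]; auto.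
rewrite <- Cmod_opp in hz.
rewrite <- point_prod_p3, <- point_prod_p2.
(* Point sums and point products are symmetric in the p's and in the r's; the permutation puts
   AB/(ab) into the place of r4. *)
assert (Es : forall p, sum_at p = CSeries (point_term q p3 1 p1 p4 y r2 A r3 p))
  by (intros p; apply CSeries_ext; intros m; unfold point_term; ring).
assert (Ep : forall p, point_prod q y r2 r3 A p = point_prod q y r2 A r3 p)
  by (intros p; unfold point_prod; ring).
rewrite !Es, !Ep.
match goal with |- _ * (?u - p3 * ?v) = _ =>
  replace (p3 * v) with (p3 / 1 * v) by (field; exact C1_nz) end.
unfold vwp2.
etransitivity; [apply (watson_points q hq0 hq p3 1 p1 p4 y r2 A r3 (x * y * a ^ 2 / B)
  y (- (x * a / B)) A (- (y * a / B)) (- (x * a ^ 2 * b / (A * B)))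
  (x * a ^ 2 / B) (- (y * a)) (x * y * a ^ 2 / (A * B)) (- (x * a)) (- (y * A / b))
  (- (B / b))); auto using C1_nz; unfold p1, p3, p4, r2, r3;
  field; repeat split; auto using C1_nz |].
unfold qpochs_inf, fold_right, p3.
replace (- (a / A) / 1) with (- (a / A)) by (field; auto).
replace (q * 1 / - (a / A)) with (- (A * q / a)) by (field; auto).
ring.
Qed.

Let relation3 :
  (Cmod (b * q / A) < 1)%R ->
  (forall k, W87_den (x * a ^ 2 / (y * A)) (q / y) (- (x * a / y))
    (x * a ^ 2 / (A * B)) (- a) (- (B / b)) q k <> 0) ->
  qpoch_inf (x * a ^ 2 * q / (y * A)) q *
    (e1 * sum_at p3 - p1 / p3 * (e3 * sum_at p1))
  = qpochs_inf [q; b * q / (y * a); y * a / b; - (b * q / A); B * q / y;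
                - (x * a * q / (y * A)); - (x * a ^ 2 * b * q / (y * A * B));
                x * a ^ 2 / A; - (a * q / A)] q *
    CSeries (vwp3 q A B a b x y).
Proof.
intros hz hd; destruct (W_den_factors q A B a b x y) as [_ [m1 [m2 [m3 [m4 m5]]]]]; auto.
rewrite <- Cmod_opp in hz.
rewrite <- point_prod_p3, <- point_prod_p1.
assert (Es : forall p, sum_at p = CSeries (point_term q p1 p3 1 p4 r2 A r3 y p))
  by (intros p; apply CSeries_ext; intros m; unfold point_term; ring).
assert (Ep : forall p, point_prod q y r2 r3 A p = point_prod q r2 A r3 y p)
  by (intros p; unfold point_prod; ring).
rewrite !Es, !Ep.
unfold vwp3.
etransitivity; [apply (watson_points q hq0 hq p1 p3 1 p4 r2 A r3 y (x * a ^ 2 * q / (y * A))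
  (x * a ^ 2 / (A * B)) (- a) (- (B / b)) (q / y) (- (x * a / y))
  (B * q / y) (- (x * a * q / (y * A))) (- (x * a ^ 2 * b * q / (y * A * B)))
  (x * a ^ 2 / A) (- (a * q / A)) (- (b * q / A))); auto using C1_nz;
  unfold p1, p3, p4, r2, r3; field; repeat split; auto using C1_nz |].
unfold qpochs_inf, fold_right, p1, p3.
replace (- (b * q / (y * A)) / - (a / A)) with (b * q / (y * a)) by (field; auto).
replace (q * - (a / A) / - (b * q / (y * A))) with (y * a / b) by (field; auto).
ring.
Qed.

Hypotheses (hlambda : lambda_den q A B a b x y <> 0) (htheta : theta_den q A B a b x y <> 0)
  (hrhs : rhs_den q A B a b x y <> 0).
Hypotheses (hsum1 : forall k, sum1_den q A B a b x y k <> 0)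
  (hsum2 : forall k, sum2_den q A B a b x y k <> 0).

Let k1 : C := qpochs_inf [q; - (b * q / (y * A)); - (y * A / b); - (b * q / y); x * q / y;
                - (B * q / a); x * a * b * q / (A * B); - (x * a); - (A * q / a)] q.

Let k2 : C := qpochs_inf [q; - (a / A); - (A * q / a); - (B / b); x * a ^ 2 / B; - (y * a);
                x * y * a ^ 2 / (A * B); - (x * a); - (y * A / b)] q.

Let k3 : C := qpochs_inf [q; b * q / (y * a); y * a / b; - (b * q / A); B * q / y;
                - (x * a * q / (y * A)); - (x * a ^ 2 * b * q / (y * A * B));
                x * a ^ 2 / A; - (a * q / A)] q.

Let const1 : C := (1 - x) / ((1 + A / a) * (1 + B / a) * (1 - x * a * b / (A * B))).

Let const2 : C := (1 - x * y * a ^ 2 / (B * q)) /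
    ((1 + y * a / q) * (1 + y * A / (b * q)) * (1 - x * y * a ^ 2 / (A * B * q))).

Let k1_neq_0 : k1 <> 0.
Proof.
destruct (sum1_den_factors q A B a b x y) as [_ [m1 [m2 [m3 [m4 m5]]]]]; auto.
pose proof (qpochs_inf_neq_0 _ _ hlambda) as zl.
pose proof (qpochs_inf_neq_0 _ _ htheta) as zt.
pose proof (qpochs_inf_neq_0 _ _ hrhs) as zr.
unfold k1, qpochs_inf, fold_right.
repeat apply Cmult_neq_0; auto using C1_nz, qpoch_inf_neq_0, qpoch_inf_neq_0_of_lt_1;
  solve [apply zt; simpl; tauto | apply zr; simpl; tauto].
Qed.

Let e3_neq_0 : e3 <> 0.
Proof.
pose proof (qpochs_inf_neq_0 _ _ hlambda) as zl.
pose proof (qpochs_inf_neq_0 _ _ htheta) as zt.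
pose proof (qpochs_inf_neq_0 _ _ hrhs) as zr.
unfold e3, qpochs_inf, fold_right.
repeat apply Cmult_neq_0; auto using C1_nz;
  solve [apply zt; simpl; tauto | apply zr; simpl; tauto].
Qed.

Let step (u v : C) : v = u * q -> qpoch_inf u q = (1 - u) * qpoch_inf v q.
Proof. intros ->; now apply qpoch_inf_step. Qed.

Let lambda_coef :
  1 / a * const1 * (qpoch_inf (x * q) q / (k1 * e3) * (e1 * k2 / qpoch_inf (x * y * a ^ 2 / B) q))
  = lambda q A B a b x y / b * const2.
Proof.
destruct (sum1_den_factors q A B a b x y) as [[n1 [n2 n3]] _]; auto.
destruct (sum2_den_factors q A B a b x y) as [[n4 [n5 n6]] _]; auto.
assert (S1 : qpoch_inf x q = (1 - x) * qpoch_inf (x * q) q) by (apply step; ring).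
assert (S2 : qpoch_inf (- (B / a)) q = (1 + B / a) * qpoch_inf (- (B * q / a)) q)
  by (rewrite (step _ (- (B * q / a))) by (field; auto); ring).
assert (S3 : qpoch_inf (x * a * b / (A * B)) q
    = (1 - x * a * b / (A * B)) * qpoch_inf (x * a * b * q / (A * B)) q)
  by (apply step; field; auto).
assert (S4 : qpoch_inf (- (y * a / q)) q = (1 + y * a / q) * qpoch_inf (- (y * a)) q)
  by (rewrite (step _ (- (y * a))) by (field; auto); ring).
assert (S5 : qpoch_inf (x * y * a ^ 2 / (A * B * q)) q
    = (1 - x * y * a ^ 2 / (A * B * q)) * qpoch_inf (x * y * a ^ 2 / (A * B)) q)
  by (apply step; field; auto).
assert (S6 : qpoch_inf (x * y * a ^ 2 / (B * q)) q
    = (1 - x * y * a ^ 2 / (B * q)) * qpoch_inf (x * y * a ^ 2 / B) q)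
  by (apply step; field; auto).
assert (S7 : qpoch_inf (- (b * q / (y * A))) q
    = (1 + b * q / (y * A)) * qpoch_inf (- (b * q ^ 2 / (y * A))) q)
  by (rewrite (step _ (- (b * q ^ 2 / (y * A)))) by (field; auto); ring).
assert (S8 : qpoch_inf (- (a / A)) q = (1 + a / A) * qpoch_inf (- (a * q / A)) q)
  by (rewrite (step _ (- (a * q / A))) by (field; auto); ring).
pose proof k1_neq_0 as hk; pose proof e3_neq_0 as he; revert hk he.
pose proof (qpochs_inf_neq_0 _ _ hlambda) as zl.
pose proof (zl (x * y * a ^ 2 / (B * q)) ltac:(simpl; tauto)) as z6.
(* This product occurs in [lambda_den]. Hence its first factor, which is the numerator of [const2],
   and its tail, by which the left side is divided, are both nonzero. *)
rewrite S6 in z6.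
unfold lambda, lambda_den, k1, k2, e1, e3, const1, const2, qpochs_inf, fold_right.
rewrite S1, S2, S3, S4, S5, S6, S7, S8.
set (m6 := 1 - x * y * a ^ 2 / (B * q)) in *.
assert (n7 : m6 <> 0) by (intros E; apply z6; rewrite E; ring).
assert (z7 : qpoch_inf (x * y * a ^ 2 / B) q <> 0) by (intros E; apply z6; rewrite E; ring).
clear - n1 n2 n3 n4 n5 n6 n7 z7 hA hB ha hb hx hy hq0.
(* 1 + a/A comes from (-a/A; q)_oo in [k2], 1 + A/a from [const1]; likewise 1 + bq/(yA) comes from
   [k1] and 1 + yA/(bq) from [const2]. Rewritten as multiples of the factors known to be nonzero,
   they cancel. *)
replace (1 + a / A) with ((1 + A / a) * (a / A)) by (field; auto).
replace (1 + b * q / (y * A)) with ((1 + y * A / (b * q)) * (b * q / (y * A)))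
  by (field; auto).
intros hk he.
set (m1 := 1 + A / a) in *; set (m2 := 1 + B / a) in *.
set (m3 := 1 - x * a * b / (A * B)) in *; set (m4 := 1 + y * a / q) in *.
set (m5 := 1 - x * y * a ^ 2 / (A * B * q)) in *; set (m7 := 1 + y * A / (b * q)) in *.
clearbody m1 m2 m3 m4 m5 m6 m7.
abstract_qpoch_inf q; split_neq_0.
field; repeat split; assumption.
Qed.

Let rhs_coef : A + b <> 0 ->
  1 / a * const1 * (qpoch_inf (x * q) q / (k1 * e3) *
    (p3 * e2 * k3 / qpoch_inf (x * a ^ 2 * q / (y * A)) q))
  = rhs_factor q A B a b x y.
Proof.
intros hAb.
destruct (sum1_den_factors q A B a b x y) as [[n1 [n2 n3]] _]; auto.
assert (S1 : qpoch_inf x q = (1 - x) * qpoch_inf (x * q) q) by (apply step; ring).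
assert (S2 : qpoch_inf (- (B / a)) q = (1 + B / a) * qpoch_inf (- (B * q / a)) q)
  by (rewrite (step _ (- (B * q / a))) by (field; auto); ring).
assert (S3 : qpoch_inf (x * a * b / (A * B)) q
    = (1 - x * a * b / (A * B)) * qpoch_inf (x * a * b * q / (A * B)) q)
  by (apply step; field; auto).
assert (S4 : qpoch_inf (- (A / a)) q = (1 + A / a) * qpoch_inf (- (A * q / a)) q)
  by (rewrite (step _ (- (A * q / a))) by (field; auto); ring).
assert (S5 : qpoch_inf (- (b / A)) q = (1 + b / A) * qpoch_inf (- (b * q / A)) q)
  by (rewrite (step _ (- (b * q / A))) by (field; auto); ring).
pose proof k1_neq_0 as hk; pose proof e3_neq_0 as he; revert hk he.
pose proof (qpochs_inf_neq_0 _ _ htheta (x * a ^ 2 * q / (y * A)) ltac:(simpl; tauto)) as z6.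
unfold rhs_factor, theta, theta_den, rhs_den, k1, k3, e2, e3, p3, const1, qpochs_inf, fold_right.
rewrite S1, S2, S3, S4, S5.
clear - n1 n2 n3 z6 hA hB ha hb hx hy hq0 hAb.
(* This factor of (-b/A; q)_oo cancels the A + b in [theta] and leaves -1/A, which is p3/a on the
   left side. *)
replace (1 + b / A) with ((A + b) / A) by (field; auto).
intros hk he.
set (m1 := 1 + A / a) in *; set (m2 := 1 + B / a) in *.
set (m3 := 1 - x * a * b / (A * B)) in *; set (m4 := A + b) in *.
clearbody m1 m2 m3 m4.
abstract_qpoch_inf q; split_neq_0.
field; repeat split; assumption.
Qed.

Lemma three_term_relation : A + b <> 0 ->
  (Cmod (b * q / y) < 1)%R -> (Cmod (B / b) < 1)%R -> (Cmod (b * q / A) < 1)%R ->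
  (forall k, W87_den (x * a ^ 2 / (y * A)) (q / y) (- (x * a / y))
    (x * a ^ 2 / (A * B)) (- a) (- (B / b)) q k <> 0) ->
  1 / a * (const1 * CSeries (vwp1 q A B a b x y))
  - lambda q A B a b x y / b * (const2 * CSeries (vwp2 q A B a b x y))
  = rhs_factor q A B a b x y * CSeries (vwp3 q A B a b x y).
Proof.
intros hAb z1 z2 z3 hW.
pose proof (relation1 z1 hsum1) as R1; pose proof (relation2 z2 hsum2) as R2.
pose proof (relation3 z3 hW) as R3; fold k1 in R1; fold k2 in R2; fold k3 in R3.
assert (d2 : qpoch_inf (x * y * a ^ 2 / B) q <> 0).
{ intros E; apply (qpochs_inf_neq_0 _ _ hlambda (x * y * a ^ 2 / (B * q)));
    [simpl; tauto|].
  rewrite (step _ (x * y * a ^ 2 / B)) by (field; auto); rewrite E; ring. }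
pose proof (qpochs_inf_neq_0 _ _ htheta (x * a ^ 2 * q / (y * A)) ltac:(simpl; tauto)) as d3.
(* The three point sums are eliminated here, and the first 8W7 becomes a combination of the other
   two; only the coefficients remain to be compared. *)
rewrite (three_point_elim _ _ _ _ _ _ _ _ _ _ _ _ _ _ _ _ _ hp3 d2 d3 e3_neq_0 k1_neq_0 R1 R2 R3).
rewrite <- (rhs_coef hAb).
transitivity (1 / a * const1 * (qpoch_inf (x * q) q / (k1 * e3) *
    (e1 * k2 / qpoch_inf (x * y * a ^ 2 / B) q)) * CSeries (vwp2 q A B a b x y)
  - lambda q A B a b x y / b * const2 * CSeries (vwp2 q A B a b x y)
  + 1 / a * const1 * (qpoch_inf (x * q) q / (k1 * e3) *
    (p3 * e2 * k3 / qpoch_inf (x * a ^ 2 * q / (y * A)) q)) * CSeries (vwp3 q A B a b x y));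
  [ring | rewrite lambda_coef; ring].
Qed.

End Relations.

Theorem theorem1 (q A B a b x y : C)
  (hq0 : (0 < Cmod q)%R) (hq1 : (Cmod q < 1)%R)
  (hmax : (Rmax (Cmod (b * q / y)) (Rmax (Cmod (B / b)) (Cmod (b * q / A))) < 1)%R)
  (* every expression is well defined: no denominator vanishes *)
  (hA : A <> 0) (hB : B <> 0) (ha : a <> 0) (hb : b <> 0)
  (hx : x <> 0) (hy : y <> 0) (hAb : A + b <> 0)
  (hlambda : lambda_den q A B a b x y <> 0)
  (htheta : theta_den q A B a b x y <> 0)
  (hrhs : rhs_den q A B a b x y <> 0)
  (hsum1 : forall k : nat, sum1_den q A B a b x y k <> 0)
  (hsum2 : forall k : nat, sum2_den q A B a b x y k <> 0)
  (hW : forall k : nat,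
     W87_den (x * a ^ 2 / (y * A)) (q / y) (- (x * a / y))
       (x * a ^ 2 / (A * B)) (- a) (- (B / b)) q k <> 0) :
  ex_Cseries (sum1_term q A B a b x y) /\
  ex_Cseries (sum2_term q A B a b x y) /\
  ex_Cseries
    (W87_term (x * a ^ 2 / (y * A)) (q / y) (- (x * a / y))
       (x * a ^ 2 / (A * B)) (- a) (- (B / b)) q (- (b * q / A))) /\
  1 / a * CSeries (sum1_term q A B a b x y)
  - lambda q A B a b x y / b * CSeries (sum2_term q A B a b x y)
  = rhs_factor q A B a b x y *
    W87 (x * a ^ 2 / (y * A)) (q / y) (- (x * a / y))
      (x * a ^ 2 / (A * B)) (- a) (- (B / b)) q (- (b * q / A)).
Proof.
assert (q0 : q <> 0) by (now apply Cmod_gt_0).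
apply Rmax_Rlt in hmax; destruct hmax as [z1 hmax].
apply Rmax_Rlt in hmax; destruct hmax as [z2 z3].
assert (H1 : has_sum (sum1_term q A B a b x y)
  ((1 - x) / ((1 + A / a) * (1 + B / a) * (1 - x * a * b / (A * B))) *
   CSeries (vwp1 q A B a b x y))).
{ eapply has_sum_scal_ext; [apply sum1_term_vwp; assumption|].
  destruct (sum1_den_factors q A B a b x y) as [_ [m1 [m2 [m3 [m4 m5]]]]]; auto.
  unfold vwp1; eapply vwp_series_has_sum; auto; now rewrite Cmod_opp. }
assert (H2 : has_sum (sum2_term q A B a b x y)
  ((1 - x * y * a ^ 2 / (B * q)) /
    ((1 + y * a / q) * (1 + y * A / (b * q)) * (1 - x * y * a ^ 2 / (A * B * q))) *
   CSeries (vwp2 q A B a b x y))).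
{ eapply has_sum_scal_ext; [apply sum2_term_vwp; assumption|].
  destruct (sum2_den_factors q A B a b x y) as [_ [m1 [m2 [m3 [m4 m5]]]]]; auto.
  unfold vwp2; eapply vwp_series_has_sum; auto; now rewrite Cmod_opp. }
assert (H3 : has_sum (W87_term (x * a ^ 2 / (y * A)) (q / y) (- (x * a / y))
       (x * a ^ 2 / (A * B)) (- a) (- (B / b)) q (- (b * q / A)))
   (CSeries (vwp3 q A B a b x y))).
{ eapply has_sum_ext; [intros k; symmetry; apply W_term_vwp; assumption|].
  destruct (W_den_factors q A B a b x y) as [_ [m1 [m2 [m3 [m4 m5]]]]]; auto.
  unfold vwp3; eapply vwp_series_has_sum; auto; now rewrite Cmod_opp. }
split; [|split; [|split]]; try (eexists; apply has_sum_is_series; eassumption).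
unfold W87.
rewrite (has_sum_CSeries _ _ H1), (has_sum_CSeries _ _ H2), (has_sum_CSeries _ _ H3).
now apply three_term_relation.
Qed.
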